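(* Let $p\in[1,\infty)$, let $X_1,\dots,X_N$ be Polish spaces and $\mu_i\in\mathcal{P}_p(X_i)$ for $i=1,\dots,N$, and let $c:X\to\mathbb{R}$ be continuous with growth of order $p$ on $X=\prod_{i=1}^N X_i$. Assume that $\mu_i$ satisfies ${\sf quant}_p(C,\alpha_i)$ for $i=2,\dots,N$ and that $c$ satisfies $({\rm A}_{L,C})$, for some $\alpha_2,\dots,\alpha_N\in(0,1]$ and $L,C\ge 0$. (i) Let $f(x)=x\log(x)$. Then for all $\varepsilon\in(0,1]$, $$\mathsf{OT}_{f,\varepsilon}-\mathsf{OT}\le\Big(\sum_{i=2}^N\frac{1}{\alpha_i}\Big)\varepsilon\log\Big(\frac1\varepsilon\Big)+4(N-1)^{1/p}LC\,\varepsilon .$$ (ii) Let $f(x)=x\varphi(x)$, $\beta=\sum_{i=2}^N\frac{1}{\alpha_i}$ and $\tilde f(x)=x\varphi(x^\beta)$. Assume that for some $x_0,y_0\ge 0$, $\tilde f$ is strictly increasing on $[x_0,\infty)$ with inverse $\tilde f_{\mathrm{inv}}$, and that $\varphi$ is nondecreasing. Suppose also that either $N=2$ and $\varphi$ is concave, or the $\mu_i$ ($i=2,\dots,N$) satisfy ${\sf quant}^{em}_p(C,\alpha_i)$ instead of ${\sf quant}_p(C,\alpha_i)$. Set $S_\varepsilon=\tilde f_{\mathrm{inv}}(\frac1\varepsilon)$, which satisfies $\lim_{\varepsilon\to0}S_\varepsilon=\infty$ and $\lim_{\varepsilon\to0}\varepsilon S_\varepsilon=0$. Then for all $\varepsilon\in(0,1/x_0]$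 small enough such that $S_\varepsilon$ is defined and $S_\varepsilon\ge y_0^{1/\beta}+1$, $$\mathsf{OT}_{f,\varepsilon}-\mathsf{OT}\le\frac{4(N-1)^{1/p}LC+1}{S_\varepsilon}.$$
   Context: For a Polish space $(Y,d_Y)$, $\mathcal{P}(Y)$ is the set of Borel probability measures and $\mathcal{P}_p(Y)$ the subset with finite $p$-th moment. $W_p(\mu,\nu)^p=\inf_{\pi\in\Pi(\mu,\nu)}\int d_Y(x,y)^p\,\pi(dx,dy)$ is the $p$-Wasserstein distance. $N\in\mathbb{N}$; the product $X=\prod_{i=1}^N X_i$ carries the metric $d_{X,p}(x,y)=(\sum_{i=1}^N d_{X_i}(x_i,y_i)^p)^{1/p}$, which induces $W_p$ on $X$. The cost $c$ has growth of order $p$ if $|c(x)|\le C'(1+d_{X,p}(x,\hat x)^p)$ for some $C'\ge0$, $\hat x\in X$. $\Pi(\mu_1,\dots,\mu_N)$ is the set of couplings of $\mu_1,\dots,\mu_N$. The function $f:\mathbb{R}_+=[0,\infty)\to\mathbb{R}$ is strictly convex and bounded below with $f(1)=0$ and $\lim_{x\to\infty}f(x)/x=\infty$. $D_f(\mu,\nu)=\int f(\frac{d\mu}{d\nu})\,d\nu$ if $\mu\ll\nu$ and $D_f(\mu,\nu)=\infty$ otherwise. With $P=\mu_1\otimes\cdots\otimes\mu_N$ and $\varepsilon>0$, $$\mathsf{OT}=\inf_{\pi\in\Pi(\mu_1,\dots,\mu_N)}\int c\,d\pi,\qquad \mathsf{OT}_{f,\varepsilon}=\inf_{\pi\in\Pi(\mu_1,\dots,\mu_N)}\int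 c\,d\pi+\varepsilon D_f(\pi,P).$$ When $f(x)=x\varphi(x)$, $\varphi$ is a real function on $(0,\infty)$ and the value $f(0)$ is read as $\lim_{x\downarrow0}x\varphi(x)$. We use $1/x_0=+\infty$ if $x_0=0$. $\mathcal{P}^n(Y)$: probability measures supported on at most $n$ points. $\mathcal{P}^{n,em}(Y)$: measures of the form $n^{-1}\sum_{i=1}^n\delta_{y_i}$, $y_i\in Y$. For $C\ge0$, $\alpha>0$, $\mu\in\mathcal{P}_p(Y)$ satisfies ${\sf quant}_p(C,\alpha)$ if for every $n\ge1$ there is $\mu^n\in\mathcal{P}^n(Y)$ with $W_p(\mu^n,\mu)\le Cn^{-\alpha}$; it satisfies ${\sf quant}^{em}_p(C,\alpha)$ if for every $n\ge1$ there is $\mu^n\in\mathcal{P}^{n,em}(Y)$ with $W_p(\mu^n,\mu)\le Cn^{-\alpha}$. $c$ satisfies $({\rm A}_{L,C})$ if for all $\tilde\mu_i\in\mathcal{P}_p(X_i)$ with $W_p(\tilde\mu_i,\mu_i)\le C$, $i=1,\dots,N$, we have $|\int c\,d(\pi-\tilde\pi)|\le L\,W_p(\pi,\tilde\pi)$ for all $\pi\in\Pi(\mu_1,\dots,\mu_N)$ and $\tilde\pi\in\Pi(\tilde\mu_1,\dots,\tilde\mu_N)$. *)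

(* Defs.v *)
From HB Require Import structures.
From mathcomp Require Import all_boot all_order all_algebra.
From mathcomp Require Import all_classical all_reals all_analysis.

Set Implicit Arguments.
Unset Strict Implicit.
Unset Printing Implicit Defensive.

Import Order.TTheory GRing.Theory Num.Theory.
Import numFieldNormedType.Exports.

Local Open Scope classical_set_scope.
Local Open Scope ring_scope.

HB.mixin Record isSeparable T & Topological T := {
  separable : exists2 D : set T, countable D & dense D
}.

(* The points demanded by [Complete] exclude only the empty space, which
   carries no probability measure. *)
#[short(type="polishType")]
HB.structure Definition Polish (R : numDomainType) :=
  {T of Metric R T & Complete T & isSeparable T}.

Definition borel (T : ptopologicalType) := g_sigma_algebraType (@open T).

Definition mprod (I : finType) (d : I -> measure_display)
  (T : forall i, measurableType (d i)) : Type := forall i, T i.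

Lemma mprod_display : measure_display.
Proof. exact: default_measure_display. Qed.

Section product_sigma_algebra.
Context (I : finType) (d : I -> measure_display)
  (T : forall i, measurableType (d i)).

Definition mprod_cylinders : set (set (mprod T)) :=
  \bigcup_(i in [set: I])
    preimage_set_system setT (fun x : mprod T => x i) measurable.

HB.instance Definition _ := gen_eqMixin (mprod T).
HB.instance Definition _ := gen_choiceMixin (mprod T).
HB.instance Definition _ := isPointed.Build (mprod T) (fun=> point).
HB.instance Definition _ := @isMeasurable.Build mprod_display (mprod T)
  <<s mprod_cylinders >> (@sigma_algebra0 _ setT _)
  (@sigma_algebraC _ _) (@sigma_algebra_bigcup _ setT _).

Lemma measurable_proj i (A : set (T i)) :
  measurable A -> measurable [set x : mprod T | A (x i)].
Proof.
move=> mA; apply: sub_sigma_algebra; exists i => //.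
by exists A => //; rewrite setTI.
Qed.

Lemma measurable_box (A : forall i, set (T i)) :
  (forall i, measurable (A i)) ->
  measurable [set x : mprod T | forall i, A i (x i)].
Proof.
move=> mA.
rewrite (_ : [set x : mprod T | _] =
    \bigcap_(i in [set: I]) [set x : mprod T | A i (x i)]); last first.
  by apply/seteqP; split=> x /= Ax i; [move=> _; exact: Ax|exact: (Ax i)].
by apply: fin_bigcap_measurable => // i _; exact: measurable_proj.
Qed.

Definition mprod_upd i (z : mprod T * T i) : mprod T :=
  @dfwith I T z.1 i z.2.

Lemma measurable_mprod_upd i : measurable_fun setT (@mprod_upd i).
Proof.
apply: (@measurability _ _ _ _ _ _ mprod_cylinders) => //.
move=> _ [_ [j _ [A mA <-]] <-]; rewrite !setTI.
have [ij|ij] := pselect (i = j).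
  subst j; rewrite (_ : _ @^-1` _ = setT `*` A); first exact: measurableX.
  apply/seteqP; split=> -[x y] /=; rewrite /mprod_upd/= dfwithin//.
  by case.
rewrite (_ : _ @^-1` _ = [set x : mprod T | A (x j)] `*` setT).
  by apply: measurableX => //; exact: measurable_proj.
apply/seteqP; split=> -[x y] /=; rewrite /mprod_upd/= dfwithout//; try exact/eqP.
by case.
Qed.

HB.instance Definition _ i :=
  isMeasurableFun.Build _ _ _ _ (@mprod_upd i) (@measurable_mprod_upd i).

End product_sigma_algebra.

Section product_probability.
Local Open Scope ereal_scope.
Context (R : realType) (I : finType) (d : I -> measure_display)
  (T : forall i, measurableType (d i)).

Section redraw.
Variables (nu : probability (mprod T) R) (i : I) (m : probability (T i) R).

(* The law of x after coordinate i has been replaced by an independent draw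
   from m. *)
Definition redraw : set (mprod T) -> \bar R :=
  pushforward (nu \x m) (@mprod_upd I d T i).

Let redraw0 : redraw set0 = 0. Proof. exact: measure0. Qed.

Let redraw_ge0 A : 0 <= redraw A. Proof. exact: measure_ge0. Qed.

Let redraw_sigma_additive : semi_sigma_additive redraw.
Proof.
move=> F mF tF mUF; rewrite /redraw /pushforward preimage_bigcup.
apply: measure_semi_sigma_additive.
- by move=> n; rewrite -[X in measurable X]setTI; exact: measurable_mprod_upd.
- apply/trivIsetP => /= a b _ _ ab; rewrite -preimage_setI.
  by move/trivIsetP : tF => /(_ _ _ _ _ ab) ->//; rewrite preimage_set0.
- rewrite -preimage_bigcup -[X in measurable X]setTI.
  exact: measurable_mprod_upd.
Qed.

HB.instance Definition _ := isMeasure.Build _ _ _ redraw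
  redraw0 redraw_ge0 redraw_sigma_additive.

Let redraw_setT : redraw setT = 1.
Proof.
rewrite /redraw /pushforward preimage_setT -setXTT product_measure1E//.
by rewrite -[RHS]mule1; congr (_ * _); exact: probability_setT.
Qed.

HB.instance Definition _ :=
  Measure_isProbability.Build _ _ _ redraw redraw_setT.
End redraw.

(* Every coordinate of the initial point is redrawn once, so neither that point
   nor the order of enumeration matters: see [mprod_measureE]. *)
Definition mprod_measure (m : forall i, probability (T i) R) :
    probability (mprod T) R :=
  foldr (fun i nu => redraw nu (m i)) (dirac (point : mprod T)) (enum I).

Lemma mprod_measureE (m : forall i, probability (T i) R)
    (A : forall i, set (T i)) : (forall i, measurable (A i)) ->
  mprod_measure m [set x | forall i, A i (x i)] = \prod_(i : I) m i (A i).
Proof.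
move=> mA; rewrite /mprod_measure -big_enum /=.
suff H (s : seq I) : uniq s -> forall B : forall i, set (T i),
    (forall i, measurable (B i)) -> (forall i, i \notin s -> B i point) ->
    (foldr (fun i nu => redraw nu (m i)) (dirac (point : mprod T)) s
       : probability _ _) [set x | forall i, B i (x i)] =
    \prod_(i <- s) m i (B i).
  by apply: H => //; [exact: enum_uniq|move=> i; rewrite mem_enum].
elim: s => [_ B mB Bp|i s IH /= /andP[iNs us] B mB Bp].
  by rewrite big_nil /= diracE mem_set// => i; exact: Bp.
rewrite big_cons /= /redraw /pushforward.
pose B' j : set (T j) := if j == i then setT else B j.
rewrite (_ : _ @^-1` _ = [set x | forall j, B' j (x j)] `*` B i); last first.
  apply/seteqP; split=> -[x y]; rewrite /mprod_upd /B' /=.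
    move=> h; split; last by have := h i; rewrite dfwithin.
    move=> j; case: eqVneq => // ji.
    by have := h j; rewrite dfwithout// eq_sym.
  move=> [h Biy] j; have [ij|/eqP ij] := pselect (i = j).
    by subst j; rewrite dfwithin.
  by have := h j; rewrite eq_sym (negbTE ij) dfwithout.
have mB' j : measurable (B' j) by rewrite /B'; case: ifP.
rewrite product_measure1E//; last exact: measurable_box.
rewrite [RHS]muleC; congr (_ * _).
have -> : \prod_(j <- s) m j (B j) = \prod_(j <- s) m j (B' j).
  apply: eq_big_seq => j js.
  by rewrite /B'; case: eqVneq => // ji; move: iNs; rewrite -ji js.
apply: IH => // j js; rewrite /B'; case: eqVneq => // ji.
by apply: Bp; rewrite inE negb_or ji.
Qed.

End product_probability.

Section wasserstein.
Local Open Scope ereal_scope.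
Context (R : realType) (d : measure_display) (Y : measurableType d).
Variables (dist : Y -> Y -> R) (p : R).

Definition finite_moment (mu : probability Y R) :=
  exists y0, \int[mu]_y (dist y0 y `^ p)%:E < +oo.

Definition plans (mu nu : probability Y R) : set (probability (Y * Y)%type R) :=
  [set pi | forall A, measurable A ->
    pi (A `*` setT) = mu A /\ pi (setT `*` A) = nu A].

Definition wasserstein (mu nu : probability Y R) : \bar R :=
  ereal_inf [set \int[pi]_z (dist z.1 z.2 `^ p)%:E | pi in plans mu nu] `^ p^-1.
End wasserstein.

Definition bdist (R : realType) (Y : polishType R) : borel Y -> borel Y -> R :=
  mdist.

Section quantization.
Local Open Scope ereal_scope.
Context (R : realType) (Y : polishType R).
Implicit Type mu : probability (borel Y) R.

Definition finitely_supported (n : nat) mu :=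
  exists2 A : set (borel Y), (A #<= `I_n)%card & mu A = 1.

Definition empirical (n : nat) mu :=
  exists y : 'I_n -> Y, forall A : set (borel Y), measurable A ->
    mu A = (n%:R^-1)%:E * \sum_(i < n) \d_(y i : borel Y) A.

Definition quant (p C a : R) mu := forall n, (0 < n)%N ->
  exists2 mun : probability (borel Y) R, finitely_supported n mun &
    wasserstein (@bdist R Y) p mun mu
      <= (C * n%:R `^ (- a))%:E.

Definition quant_em (p C a : R) mu := forall n, (0 < n)%N ->
  exists2 mun : probability (borel Y) R, empirical n mun &
    wasserstein (@bdist R Y) p mun mu
      <= (C * n%:R `^ (- a))%:E.
End quantization.

Section divergence.
Context (R : realType).

Definition divergence_function (f : R -> R) :=
  [/\ forall x y t, 0 <= x -> 0 <= y -> x != y -> 0 < t < 1 ->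
        f (t * x + (1 - t) * y) < t * f x + (1 - t) * f y,
      exists m, forall x, 0 <= x -> m <= f x,
      f 1 = 0 &
      f x / x @[x --> +oo] --> +oo].

Local Open Scope ereal_scope.
Context (d : measure_display) (T : measurableType d).

(* The representative of the density chosen by the library may be negative on
   a null set, hence the maximum with 0. *)
Definition divergence (f : R -> R) (mu nu : probability T R) : \bar R :=
  if `[< mu `<< nu >] then
    \int[nu]_x (f (Num.max 0 (fine (Radon_Nikodym (charge_of_finite_measure mu) nu x))))%:E
  else +oo.
End divergence.

(* x |-> x * phi x for a function phi on (0, +oo), extended to 0 by the limit. *)
Definition xmul (R : realType) (phi : R -> R) (x : R) : R :=
  if x == 0 then lim (y * phi y @[y --> 0^'+]) else x * phi x.

Definition concave_on_pos (R : realType) (phi : R -> R) :=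
  forall x y t, 0 < x -> 0 < y -> 0 <= t <= 1 ->
    t * phi x + (1 - t) * phi y <= phi (t * x + (1 - t) * y).

(* The product sigma-algebra is the Borel sigma-algebra of the product
   topology: see [measurable_pspaceE]. *)
Definition pspace (R : realType) (N : nat) (X : 'I_N -> polishType R) : Type :=
  mprod (fun i => borel (X i) : measurableType (sigma_display (@open (X i)))).

HB.instance Definition _ (R : realType) (N : nat) (X : 'I_N -> polishType R) :=
  Measurable.on (pspace X).

Section borel_product.
Context (R : realType) (N : nat) (X : 'I_N -> polishType R).

Lemma metric_ball_open (M : metricType R) (x : M) e : open (ball x e).
Proof.
rewrite openE => y; rewrite ballEmdist /= => xy.
apply/nbhs_ballP; exists (e - mdist x y); first by rewrite /= subr_gt0.
move=> z; rewrite ballEmdist /= => yz.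
by apply: le_lt_trans (metric_triangle x y z) _; rewrite -ltrBrDl.
Qed.

Lemma pspace_open_box (x : prod_topology X) (U : set (prod_topology X)) :
  nbhs x U -> exists2 e : 'I_N -> R, forall i, 0 < e i &
    forall y : prod_topology X, (forall i, ball (x i) (e i) (y i)) -> U y.
Proof.
pose F : set_system (prod_topology X) := [set V | exists2 e : 'I_N -> R,
  forall i, 0 < e i & forall y, (forall i, ball (x i) (e i) (y i)) -> V y].
have FF : Filter F.
  split.
  - by exists (fun=> 1).
  - move=> V W [e e0 eV] [e' e0' eW].
    exists (fun i => Num.min (e i) (e' i)) => [i|y xy].
      by rewrite lt_min e0 e0'.
    split; [apply: eV|apply: eW] => i.
      by apply: le_ball (xy i); rewrite ge_min lexx.
    by apply: le_ball (xy i); rewrite ge_min lexx orbT.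
  - by move=> V W VW [e e0 eV]; exists e => // y /eV/VW.
suff Fx : F --> x by move=> /Fx.
apply/cvg_sup => i V /=.
move=> [B [[A oA <-] /= Ax] AV].
have /nbhs_ballP[r /= r0 rA] : nbhs (x i) A by exact: open_nbhs_nbhs.
by exists (fun=> r) => // y xy; apply: AV; exact/rA/xy.
Qed.

Lemma measurable_pspaceE : (measurable : set (set (pspace X))) =
  <<s (open : set (set (prod_topology X))) >>.
Proof.
apply/seteqP; split.
  apply: smallest_sub; first exact: smallest_sigma_algebra.
  move=> _ [i _ [A mA <-]].
  have : preimage_set_system setT (fun x : pspace X => x i)
      (<<s (open : set (set (X i))) >>) (setT `&` (fun x => x i) @^-1` A).
    by exists A.
  rewrite -(@g_sigma_preimageE _ (X i) setT).
  apply: smallest_sub; first exact: smallest_sigma_algebra.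
  move=> _ [B oB <-]; apply: sub_sigma_algebra; rewrite setTI.
  by apply: (open_comp _ oB) => x _; exact: (@proj_continuous _ X i).
apply: smallest_sub; first exact: sigma_algebra_measurable.
move=> U oU.
have D_ i : {D : nat -> X i | dense (range D)}.
  apply: cid; have [S /countable_injP[f fS] dS] := @separable R (X i).
  exists (fun n => xget point [set s | S s /\ f s = n]) => O O0 oO.
  have [s [Os Ss]] := dS O O0 oO; exists s; split => //; exists (f s) => //.
  case: xgetP => [y _ [Sy fy]|/(_ s)]; last by case.
  by apply: fS; rewrite ?inE.
pose box (b : {ffun 'I_N -> nat * nat}) : set (pspace X) :=
  [set x | forall i, ball (sval (D_ i) (b i).1) (b i).2.+1%:R^-1 (x i)].
rewrite (_ : (U : set (pspace X)) =
    \bigcup_b if pselect (box b `<=` U) then box b else set0).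
  apply: countable_bigcupT_measurable => [|a]; first exact: countableP.
  case: pselect => a0 /=; last exact: measurable0.
  apply: (@measurable_box _ _ (fun i => borel (X i))
    (fun i => ball (sval (D_ i) (a i).1) (a i).2.+1%:R^-1)) => i.
  by apply: sub_sigma_algebra; exact: metric_ball_open.
apply/seteqP; split => [x Ux|x [b _]]; last by case: pselect => // bU /bU.
have [e e0 eU] := @pspace_open_box x U (open_nbhs_nbhs (conj oU Ux)).
have /(_ _)/cid h i : exists b : nat * nat,
    ball (sval (D_ i) b.1) b.2.+1%:R^-1 (x i) /\ b.2.+1%:R^-1 < e i / 2.
  have e20 : 0 < e i / 2 by rewrite divr_gt0.
  have [k] := ltr_add_invr e20; rewrite add0r => ke.
  have k0 : 0 < (k.+1%:R^-1 : R) by rewrite invr_gt0.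
  have [||z [xz [n _ nz]]] := svalP (D_ i) (ball (x i) k.+1%:R^-1).
  - by exists (x i); exact: ball_center (PosNum k0).
  - exact: metric_ball_open.
  - by exists (n, k); split => //=; rewrite nz; exact: ball_sym.
exists [ffun i => sval (h i)] => //; case: pselect => [_ i|[y yb]].
  by rewrite ffunE; case: (h i) => ? [].
apply: eU => i; have := yb i; rewrite ffunE; case: (h i) => /= b [xb be] yb'.
rewrite (splitr (e i)); apply: (@ball_triangle _ _ (sval (D_ i) b.1)).
  by apply: ball_sym; apply: le_ball xb; exact: ltW.
by apply: le_ball yb'; exact: ltW.
Qed.
End borel_product.

Section optimal_transport.
Local Open Scope ereal_scope.
Context (R : realType) (N : nat) (X : 'I_N -> polishType R).

Definition marginals := forall i, probability (borel (X i)) R.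

Definition dist_prod (p : R) (x y : pspace X) : R :=
  ((\sum_(i < N) mdist (x i : X i) (y i) `^ p) `^ p^-1)%R.

Definition couplings (mu : marginals) : set (probability (pspace X) R) :=
  [set pi | forall i (A : set (borel (X i))), measurable A ->
    pi [set x | A (x i)] = mu i A].

Definition prod_marginals (mu : marginals) : probability (pspace X) R :=
  mprod_measure mu.

Definition growth (p : R) (c : pspace X -> R) :=
  exists2 C : R, (0 <= C)%R &
  exists x0, forall x, (`|c x| <= C * (1 + dist_prod p x x0 `^ p))%R.

Definition cost_lipschitz (p : R) (c : pspace X -> R) (mu : marginals) (L C : R) :=
  forall mu' : marginals,
    (forall i, finite_moment (@bdist R (X i)) p (mu' i) /\
      wasserstein (@bdist R (X i)) p (mu' i) (mu i) <= C%:E) ->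
    forall pi pi', couplings mu pi -> couplings mu' pi' ->
      `| \int[pi]_x (c x)%:E - \int[pi']_x (c x)%:E |
        <= L%:E * wasserstein (dist_prod p) p pi pi'.

Definition OT (c : pspace X -> R) (mu : marginals) : \bar R :=
  ereal_inf [set \int[pi]_x (c x)%:E | pi in couplings mu].

Definition OTreg (f : R -> R) (e : R) (c : pspace X -> R) (mu : marginals) : \bar R :=
  ereal_inf [set \int[pi]_x (c x)%:E + e%:E * divergence f pi (prod_marginals mu)
            | pi in couplings mu].
End optimal_transport.

(* Main.v *)
From HB Require Import structures.
Require Import Defs.
From mathcomp Require Import all_boot all_order all_algebra.
From mathcomp Require Import all_classical all_reals all_analysis.
From mathcomp Require Import measurable_realfun.
From mathcomp Require Import ring lra.

Set Implicit Arguments.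
Unset Strict Implicit.
Unset Printing Implicit Defensive.

Import Order.TTheory GRing.Theory Num.Theory.
Import numFieldNormedType.Exports.

Local Open Scope classical_set_scope.
Local Open Scope ring_scope.

(** Only the coordinates i >= 2 are quantized. A transport plan from a
    measure [nu_i] with at most [n_i] atoms to [mu_i] yields weights [w_ij >= 0]
    with [\sum_j w_ij = 1], namely the conditional probability of the [j]-th
    atom given the point of [X_i]; let [m_ij] be the [mu_i]-integral of [w_ij].
    Given a coupling [pi] of the [mu_i], draw [x] from [pi], and for each
    [i >= 2] choose [j] with probability [w_ij(x_i)], replace [x_i] by the atom
    [a_ij] to get [y], and by an independent draw from [w_ij mu_i / m_ij] to get
    [v]. Then [v] has marginals [mu_i], [y] has marginals [mu_1, nu_2, ..., nu_N],
    and both [x] and [v] are as far from [y] as [nu_i] is from [mu_i], so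
    (A_{L,C}) applied twice bounds the change of the cost.

    Since [w_ij <= 1], the law of [v] has density at most [\prod_i b_i(x_i)]
    with respect to the product measure, where [b_i = \sum_j w_ij / m_ij].
    Here [\int b_i d mu_i] is the number of atoms, so a tangent line of the
    concave function [ln] (or [phi], when N = 2) gives
    [\int phi(\prod_i b_i) d(law v) <= phi(\prod_i n_i)]; for empirical [nu_i]
    all [m_ij >= 1 / n_i], so [b_i <= n_i] pointwise. Taking [n_i] to be the
    integer part of [S^(1 / alpha_i)] balances both errors. *)

(** The density of [v] is never computed. Only an inequality is carried along,
    [\int g d(law v) <= \int B g dP] for all nonnegative measurable [g]; it survives each redraw
    because averaging [g] over one coordinate gives another nonnegative measurable function. The
    coordinates of [v] remain dependent, so [phi] of a product of densities cannot in general be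
    integrated factor by factor. There are three ways out: [ln] splits the product into a sum, a
    single factor (N = 2) involves only one marginal, and empirical atoms bound every factor
    pointwise. This is the origin of the alternatives in the statement. Since [B >= 1] and [phi] is
    nonnegative on [1, +oo), the integrals of [phi] of the density bound need no integrability
    argument. Optimal plans are avoided: a plan is extracted from a strict bound on the distance, at
    an arbitrarily small surcharge. The constant 4 is 2 for the two uses of (A_{L,C}) times 2 for
    rounding the number of atoms to an integer. The two limits in (ii) are pure calculus: convexity
    of [x * phi x] and monotonicity make [phi] continuous, and the intermediate value theorem then
    solves the equation for S. *)

(** * Mixtures of weighted image measures *)

Section mixture.
Local Open Scope ereal_scope.
Context (R : realType) d1 d2 (B : measurableType d1) (T : measurableType d2).
Context (P : {measure set B -> \bar R}) (J : finType).
Variables (h : J -> B -> R) (F : J -> B -> T).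
Hypotheses (mh : forall j, measurable_fun setT (h j)).
Hypotheses (mF : forall j, measurable_fun setT (F j)).
Hypotheses (h0 : forall j b, (0 <= h j b)%R).

Let m (A : set T) : \bar R := \sum_(j : J) \int[P]_(b in F j @^-1` A) (h j b)%:E.

Let mFA j (A : set T) : measurable A -> measurable (F j @^-1` A).
Proof. by move=> mA; rewrite -[X in measurable X]setTI; exact: mF. Qed.

Let m0 : m set0 = 0.
Proof. by rewrite /m big1// => j _; rewrite preimage_set0 integral_set0. Qed.

Let m_ge0 A : 0 <= m A.
Proof.
by apply: sume_ge0 => j _; apply: integral_ge0 => b _; rewrite lee_fin.
Qed.

Let m_sigma_additive : semi_sigma_additive m.
Proof.
move=> A mA tA mUA.
have -> : m (\bigcup_n A n) = \sum_(n <oo) m (A n).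
  rewrite /m nneseries_sum; last first.
    by move=> j n _; apply: integral_ge0 => b _; rewrite lee_fin.
  apply: eq_bigr => j _; rewrite preimage_bigcup ge0_integral_bigcup//.
  - by move=> n; exact: mFA.
  - exact/measurable_funTS/measurable_EFinP.
  - by move=> b _; rewrite lee_fin.
  - by apply/trivIsetP => a b _ _ ab; rewrite -preimage_setI;
    move/trivIsetP : tA => /(_ _ _ I I ab) ->; rewrite preimage_set0.
by apply: is_cvg_nneseries => n _ _; exact: m_ge0.
Qed.

Let mu : {measure set T -> \bar R} :=
  HB.pack m (isMeasure.Build _ _ _ m m0 m_ge0 m_sigma_additive).

Let hE j b : 0 <= (h j b)%:E. Proof. by rewrite lee_fin. Qed.


(* Draw [b] from [P] and move to [F j b] with weight [h j b]. *)
Definition mix (g : T -> \bar R) := \int[P]_b \sum_(j : J) (h j b)%:E * g (F j b).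

Let mhg g j : measurable_fun setT g ->
  measurable_fun setT (fun b => (h j b)%:E * g (F j b)).
Proof.
move=> mg; apply: emeasurable_funM; first exact/measurable_EFinP.
exact: measurableT_comp.
Qed.

Lemma mixE g : measurable_fun setT g -> (forall t, 0 <= g t) ->
  mix g = \sum_(j : J) \int[P]_b ((h j b)%:E * g (F j b)).
Proof.
move=> mg g0; rewrite /mix; under eq_integral do rewrite -big_enum /=.
rewrite ge0_integral_sum//= ?big_enum//.
- by move=> j; exact: mhg.
- by move=> j b _; rewrite mule_ge0// lee_fin.
Qed.

Lemma measurable_mix g : measurable_fun setT g ->
  measurable_fun setT (fun b => \sum_(j : J) (h j b)%:E * g (F j b)).
Proof.
move=> mg; under eq_fun do rewrite -big_enum /=.
by apply: emeasurable_sum => j; exact: mhg.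
Qed.

Let mix_term_ge0 g b : (forall t, 0 <= g t) ->
  0 <= \sum_(j : J) (h j b)%:E * g (F j b).
Proof. by move=> g0; apply: sume_ge0 => j _; rewrite mule_ge0// lee_fin. Qed.

Let mu_indic A : measurable A -> mu A = mix (EFin \o \1_A).
Proof.
move=> mA; rewrite mixE//; last first.
- by move=> t; rewrite lee_fin.
- exact/measurable_EFinP.
apply: eq_bigr => j _; rewrite integral_mkcond; apply: eq_integral => b _.
rewrite patchE/= indicE (_ : (b \in _) = (F j b \in A)); last first.
  by apply/idP/idP; rewrite !inE.
by case: ifP => _; rewrite ?mule1 ?mule0.
Qed.

Import HBNNSimple.

Let mu_nnsfun (g : {nnsfun T >-> R}) :
  \int[mu]_t (g t)%:E = mix (EFin \o g).
Proof.
rewrite mixE//; last first.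
- by move=> t; rewrite lee_fin.
- exact/measurable_EFinP.
rewrite integralT_nnsfun sintegralE.
transitivity (\sum_(x \in range g) \sum_(j : J)
    \int[P]_b ((h j b)%:E * (x%:E * (\1_(g @^-1` [set x]) (F j b))%:E))).
  apply: eq_fsbigr => r /set_mem [t _ grt].
  have r0 : 0 <= r%:E by rewrite lee_fin -grt.
  rewrite mu_indic// mixE//; last first.
  - by move=> u; rewrite lee_fin.
  - exact/measurable_EFinP.
  rewrite ge0_sume_distrr; last first.
    move=> j _; apply: integral_ge0 => b _.
    by rewrite mule_ge0 ?lee_fin.
  apply: eq_bigr => j _; under [RHS]eq_integral do rewrite muleCA.
  rewrite ge0_integralZl//.
  - apply: (mhg (g := EFin \o \1_(g @^-1` [set r]))).
    exact/measurable_EFinP.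
  - by move=> b _; rewrite mule_ge0 ?lee_fin.
rewrite fsbig_finite//= exchange_big/=; apply: eq_bigr => j _.
have gr0 r t : 0 <= r%:E * (\1_(g @^-1` [set r]) t)%:E.
  exact: (nnfun_muleindic_ge0 g).
rewrite -ge0_integral_sum//=.
- apply: eq_integral => b _.
  rewrite [in RHS](fimfunE g) -fsumEFin//= fsbig_finite//=.
  rewrite ge0_sume_distrr; first by apply: eq_bigr => r _; rewrite EFinM.
  by move=> r _; rewrite EFinM.
- move=> r; apply: (mhg (g := fun t => r%:E * (\1_(g @^-1` [set r]) t)%:E)).
  by apply: measurable_funeM; exact/measurable_EFinP.
- by move=> r b _; rewrite mule_ge0.
Qed.

(** The usual passage from indicators to simple functions to monotone limits. Stating the result
    through integrals hides the construction: later arguments only use how the measure acts on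
    nonnegative functions. *)
Lemma mixture_measure : exists rho : {measure set T -> \bar R},
  forall g, measurable_fun setT g -> (forall t, 0 <= g t) ->
  \int[rho]_t g t = mix g.
Proof.
exists mu => g mg g0.
pose g_ := nnsfun_approx measurableT mg.
have g_g t : (g_ n t)%:E @[n --> \oo] --> g t by exact: cvg_nnsfun_approx.
have nd t : nondecreasing_seq (fun n => (g_ n t)%:E).
  by move=> a b ab; rewrite lee_fin; exact/lefP/nd_nnsfun_approx.
transitivity (limn (fun n => \int[mu]_t (g_ n t)%:E)).
  rewrite -monotone_convergence//.
  - by apply: eq_integral => t _; apply/esym/cvg_lim.
  - by move=> n; exact/measurable_EFinP.
  - by move=> n t _; rewrite lee_fin.
under eq_fun do rewrite mu_nnsfun.
rewrite /mix -monotone_convergence//.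
- apply: eq_integral => b _; apply/cvg_lim => //.
  apply: cvg_nnesum => j _ //.
  + by near=> n; rewrite mule_ge0// lee_fin.
  + by apply: cvgeZl => //; exact: g_g.
- by move=> n; apply: measurable_mix; exact/measurable_EFinP.
- by move=> n b _; apply: mix_term_ge0 => t; rewrite lee_fin.
- move=> b _ x y xy; apply: lee_sum => j _.
  by apply: lee_wpmul2l; [exact: hE|exact: nd].
Unshelve. all: by end_near. Qed.
End mixture.

Lemma mixture_probability (R : realType) d1 d2 (B : measurableType d1)
    (T : measurableType d2) (P : {measure set B -> \bar R}) (J : finType)
    (h : J -> B -> R) (F : J -> B -> T) :
  (forall j, measurable_fun setT (h j)) ->
  (forall j, measurable_fun setT (F j)) ->
  (forall j b, (0 <= h j b)%R) ->
  (\sum_(j : J) \int[P]_b (h j b)%:E = 1)%E ->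
  exists rho : probability T R, forall g, measurable_fun setT g ->
    (forall t, 0 <= g t)%E ->
    (\int[rho]_t g t = \sum_(j : J) \int[P]_b ((h j b)%:E * g (F j b)))%E.
Proof.
move=> mh mF h0 h1.
have [rho rhoE] := mixture_measure P mh mF h0.
have rho1 : rho setT = 1%E.
  have := rhoE (cst 1%E) (measurable_cst _) (fun=> lee01).
  rewrite integral_cst// mul1e => ->; rewrite mixE//.
  by under eq_bigr do under eq_integral do rewrite mule1.
(* The measure is taken apart and repacked as a probability, so that the integral formula holds for
   the new structure by conversion. *)
case: rho rhoE rho1 => rho crho rhoE rho1.
pose mrho : {measure set T -> \bar R} := Measure.Pack crho.
pose prho : probability T R := HB.pack (Measure.sort mrho)
  (Measure_isProbability.Build _ _ _ mrho rho1).
exists prho => g mg g0.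
by rewrite -mixE// -rhoE.
Qed.

Section laws.
Local Open Scope ereal_scope.
Context (R : realType).

Lemma integral_probability_cst d (T : measurableType d) (m : probability T R) r :
  \int[m]__ r = r.
Proof. by rewrite integral_cst// -[RHS]mule1; congr (_ * _); exact: probability_setT. Qed.

(** An image measure is a mixture with a single branch of weight 1. *)
Lemma law_exists d1 d2 (S : measurableType d1) (T : measurableType d2)
    (rho : probability S R) (f : S -> T) : measurable_fun setT f ->
  exists m : probability T R, forall g, measurable_fun setT g ->
    (forall x, 0 <= g x) -> \int[m]_x g x = \int[rho]_s g (f s).
Proof.
move=> mf; have [|m mE] := @mixture_probability R _ _ _ _ rho unit (fun _ _ => 1%R)
    (fun=> f) (fun=> measurable_cst _) (fun=> mf) (fun _ _ => ler01).
  rewrite (big_pred1 tt); last by case.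
  by rewrite integral_cst// mul1e; exact: probability_setT.
exists m => g mg g0; rewrite mE// (big_pred1 tt); last by case.
by apply: eq_integral => x _; rewrite mul1e.
Qed.
End laws.

Lemma integral_indicT (R : realType) d (T : measurableType d)
    (mu : {measure set T -> \bar R}) (A : set T) : measurable A ->
  (\int[mu]_x (\1_A x)%:E)%E = mu A.
Proof. by move=> mA; rewrite integral_indic// setIT. Qed.

Lemma measurable_indic_comp (R : realType) d1 d2 (T : measurableType d1)
    (Y : measurableType d2) (xi : T -> Y) (B : set Y) :
  measurable_fun setT xi -> measurable B ->
  measurable_fun setT (fun t => \1_B (xi t) : R).
Proof.
move=> mxi mB; rewrite (_ : (fun t => _) = \1_(xi @^-1` B))//.
by apply: measurable_indic; rewrite -[X in measurable X]setTI; exact: mxi.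
Qed.

(** * Conditional probabilities of a finite partition *)

Section conditional_partition.
Local Open Scope ereal_scope.
Context (R : realType) d1 d2 (T : measurableType d1) (Y : measurableType d2).
Context (kappa : {finite_measure set T -> \bar R})
        (mu : {finite_measure set Y -> \bar R}).
Variable xi : T -> Y.
Hypothesis mxi : measurable_fun setT xi.
Hypothesis xi_mu : forall B, measurable B -> kappa (xi @^-1` B) = mu B.

Lemma conditional_weight (e : T -> R) : measurable_fun setT e ->
  (forall t, (0 <= e t <= 1)%R) ->
  exists w : Y -> R, [/\ measurable_fun setT w, forall y, (0 <= w y)%R &
    forall g, measurable_fun setT g -> (forall y, 0 <= g y) ->
      \int[mu]_y ((w y)%:E * g y) = \int[kappa]_t ((e t)%:E * g (xi t))].
Proof.
move=> me e01.
have e0 t : (0 <= e t)%R by case/andP: (e01 t).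
have [nu nuE] := mixture_measure kappa (fun=> me) (fun=> mxi) (fun _ : unit => e0).
have {}nuE g : measurable_fun setT g -> (forall y, 0 <= g y) ->
    \int[nu]_y g y = \int[kappa]_t ((e t)%:E * g (xi t)).
  move=> mg g0; rewrite nuE// /mix.
  by apply: eq_integral => t _; rewrite (big_pred1 tt)// => -[].
have nu_le B : measurable B -> nu B <= mu B.
  move=> mB; rewrite -integral_indicT// nuE//; last exact/measurable_EFinP.
  rewrite -xi_mu// -[leRHS]integral_indicT; last first.
    by rewrite -[X in measurable X]setTI; exact: mxi.
  apply: ge0_le_integral => //.
  - by move=> t _; rewrite mule_ge0 ?lee_fin.
  - apply/measurable_EFinP/measurable_funM => //.
    exact: measurable_indic_comp.
  - apply/measurable_EFinP; apply: measurable_indic.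
    by rewrite -[X in measurable X]setTI; exact: mxi.
  - move=> t _; rewrite -EFinM lee_fin.
    by rewrite (_ : \1_(xi @^-1` B) t = \1_B (xi t))// ler_piMl//; case/andP: (e01 t).
have nufin : fin_num_fun nu.
  move=> B mB; rewrite ge0_fin_numE//; apply: le_lt_trans (nu_le _ mB) _.
  by rewrite ltey_eq fin_num_measure.
case: nu nuE nu_le nufin => nu cnu nuE nu_le nufin.
pose fnu : {finite_measure set Y -> \bar R} :=
  HB.pack (Measure.sort (Measure.Pack cnu)) (Measure_isFinite.Build _ _ _ (Measure.Pack cnu) nufin).
have numu : fnu `<< mu.
  apply/null_content_dominatesP => A mA A0.
  by apply/eqP; rewrite eq_le measure_ge0 andbT -A0; exact: nu_le.
pose RN := Radon_Nikodym_SigmaFinite.f fnu mu.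
have RN0 y : 0 <= RN y by exact: Radon_Nikodym_SigmaFinite.f_ge0.
have RNE y : (fine (RN y))%:E = RN y.
  by rewrite fineK//; exact: Radon_Nikodym_SigmaFinite.f_fin_num.
exists (fine \o RN); split.
- apply: measurableT_comp => //.
  exact: measurable_int (Radon_Nikodym_SigmaFinite.f_integrable _).
- by move=> y; exact: fine_ge0.
- move=> g mg g0; rewrite -nuE//.
  transitivity (\int[mu]_y (g y * RN y)).
    by apply: eq_integral => y _; rewrite muleC -RNE.
  exact: Radon_Nikodym_SigmaFinite.change_of_variables.
Qed.

Lemma conditional_partition (J : finType) (j0 : J) (e : J -> T -> R) :
  (forall j, measurable_fun setT (e j)) -> (forall j t, (0 <= e j t <= 1)%R) ->
  {ae kappa, forall t, (\sum_j e j t = 1)%R} ->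
  exists w : J -> Y -> R, [/\ forall j, measurable_fun setT (w j),
    forall j y, (0 <= w j y)%R, forall y, (\sum_j w j y = 1)%R &
    forall j g, measurable_fun setT g -> (forall y, 0 <= g y) ->
      \int[mu]_y ((w j y)%:E * g y) = \int[kappa]_t ((e j t)%:E * g (xi t))].
Proof.
move=> me e01 e1.
pose w0 j := sval (cid (conditional_weight (me j) (e01 j))).
have mw0 j : measurable_fun setT (w0 j) by rewrite /w0; case: cid => ? [].
have w00 j y : (0 <= w0 j y)%R by rewrite /w0; case: cid => ? [].
have w0E j g : measurable_fun setT g -> (forall y, 0 <= g y) ->
    \int[mu]_y ((w0 j y)%:E * g y) = \int[kappa]_t ((e j t)%:E * g (xi t)).
  by rewrite /w0; case: cid => ? [? ?]; exact.
pose s y : R := (\sum_j w0 j y)%R.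
have ms : measurable_fun setT s by apply: measurable_sum.
(* The sum of the derivatives has the same integral as 1 over every measurable set, hence equals 1
   almost everywhere. *)
have sE E : measurable E -> \int[mu]_(y in E) (s y)%:E = mu E.
  move=> mE; rewrite integral_mkcond epatch_indic.
  have ge01 j t : 0 <= (e j t)%:E * (\1_E (xi t))%:E.
    by rewrite mule_ge0// lee_fin//; case/andP: (e01 j t).
  have mxiE : measurable (xi @^-1` E).
    by rewrite -[X in measurable X]setTI; exact: mxi.
  have me1 j : measurable_fun setT (fun t => (e j t)%:E * (\1_E (xi t))%:E).
    apply: emeasurable_funM; apply/measurable_EFinP => //.
    exact: measurable_indic_comp.
  transitivity (\sum_j \int[mu]_y ((w0 j y)%:E * (\1_E y)%:E)).
    rewrite -ge0_integral_sum//=.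
    + apply: eq_integral => y _; rewrite /s -sumEFin.
      by rewrite ge0_sume_distrl// => j _; rewrite lee_fin.
    + by move=> j; apply: emeasurable_funM; exact/measurable_EFinP.
    + by move=> j y _; rewrite mule_ge0 ?lee_fin.
  transitivity (\sum_j \int[kappa]_t ((e j t)%:E * (\1_E (xi t))%:E)).
    apply: eq_bigr => j _; apply: (w0E j (EFin \o \1_E)).
    - exact/measurable_EFinP.
    - by move=> y; rewrite lee_fin.
  rewrite -xi_mu// -[RHS]integral_indicT//.
  rewrite -ge0_integral_sum//=; apply: ge0_ae_eq_integral => //.
  - exact: emeasurable_sum.
  - exact/measurable_EFinP.
  - by move=> t _; exact: sume_ge0.
  apply: filterS e1 => t et _ /=.
  rewrite -ge0_sume_distrl; last by move=> j _; rewrite lee_fin; case/andP: (e01 j t).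
  by rewrite sumEFin et mul1e.
have s1 : ae_eq mu setT (EFin \o s) (cst 1).
  apply: integral_ae_eq => //.
  - apply/integrableP; split; first exact/measurable_EFinP.
    under eq_integral do rewrite gee0_abs ?lee_fin ?sumr_ge0//.
    by rewrite sE// ltey_eq fin_num_measure.
  - by move=> E _ mE; rewrite [LHS]sE// integral_cst// mul1e.
(* On the null set where the derivatives do not add up to 1, all the weight goes to [j0]; this makes
   the sum 1 at every point without changing any integral. *)
pose w j y : R := if s y == 1%R then w0 j y else (j == j0)%:R%R.
have ae_w j : ae_eq mu setT (EFin \o w j) (EFin \o w0 j).
  apply: filterS s1 => y /= /(_ I) [sy] _.
  by rewrite /w sy eqxx.
have mw j : measurable_fun setT (w j).
  apply: measurable_fun_ifT => //.
  apply: (measurable_fun_bool true).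
  rewrite (_ : _ @^-1` _ = s @^-1` [set 1%R]); first exact: ms.
  by apply/seteqP; split => y /=; move/eqP.
exists w; split => //.
- by move=> j y; rewrite /w; case: ifP.
- move=> y; rewrite /w; have [//|_] := eqVneq (s y) 1%R.
  by rewrite (bigD1 j0)//= eqxx big1 ?addr0// => j /negbTE ->.
- move=> j g mg g0; rewrite -w0E//; apply: ae_eq_integral => //.
  + by apply: emeasurable_funM => //; exact/measurable_EFinP.
  + by apply: emeasurable_funM => //; exact/measurable_EFinP.
  + by apply: filterS (ae_w j) => y /= /(_ I) [->].
Qed.
End conditional_partition.

Lemma measurable_fun_lt (R : realType) d (T : measurableType d) (f : T -> R) :
  (forall r, measurable [set x | f x < r]) -> measurable_fun setT f.
Proof.
move=> mf; apply: (measurability (@RGenInftyO.G R)) => [|_ [_ [r ->] <-]].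
  exact: RGenInftyO.measurableE.
by rewrite setTI; rewrite (_ : _ @^-1` _ = [set x | f x < r])//; apply/seteqP;
  split => x /=; rewrite in_itv.
Qed.

(** * Borel sets and the distance of a Polish space *)

Section polish_borel.
Context (R : realType) (Y : polishType R).

Lemma borel_measurable_ball (y : borel Y) r :
  measurable [set z : borel Y | bdist y z < r].
Proof.
apply: sub_sigma_algebra.
by have := metric_ball_open (y : Y) r; rewrite ballEmdist.
Qed.

Lemma borel_measurable_set1 (y : borel Y) : measurable [set y].
Proof.
rewrite (_ : [set y] = \bigcap_n [set z : borel Y | bdist y z < n.+1%:R^-1]).
  by apply: bigcap_measurableType => n _; exact: borel_measurable_ball.
apply/seteqP; split => [z -> n _|z yz] /=; first by rewrite /bdist mdistxx.
apply/esym/(@mdist_positivity R Y)/eqP; rewrite eq_le mdist_ge0 andbT.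
rewrite leNgt; apply/negP => /ltr_add_invr[k]; rewrite add0r => k_lt.
by have := yz k I; rewrite /= ltNge (ltW k_lt).
Qed.

Lemma borel_measurable_finite (A : set (borel Y)) :
  finite_set A -> measurable A.
Proof.
move=> finA; rewrite -(fsbig_setU_set1 finA) fsbig_finite//=.
by apply: bigsetU_measurable => y _; exact: borel_measurable_set1.
Qed.

Lemma dense_sequence : exists D : nat -> Y, dense (range D).
Proof.
have [S /countable_injP[f fS] dS] := @separable R Y.
exists (fun n => xget point [set s | S s /\ f s = n]) => O O0 oO.
have [s [Os Ss]] := dS O O0 oO; exists s; split => //; exists (f s) => //.
case: xgetP => [y _ [Sy fy]|/(_ s)]; last by case.
by apply: fS; rewrite ?inE.
Qed.

(** Measurability refers to the product of the two Borel sigma-algebras, so the open set where the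
    distance is below [r] must be a countable union of rectangles. Separability supplies them: balls
    around points of a dense sequence, with radii 1 / (k + 1) and r - 1 / (k + 1). *)
Lemma measurable_bdist :
  measurable_fun setT (fun z : borel Y * borel Y => bdist z.1 z.2).
Proof.
have [D dD] := dense_sequence.
apply: measurable_fun_lt => r.
pose F (b : nat * nat) : set (borel Y * borel Y) :=
  [set x | bdist (D b.1 : borel Y) x < b.2.+1%:R^-1] `*`
  [set x | bdist (D b.1 : borel Y) x < r - b.2.+1%:R^-1].
rewrite (_ : [set z | _] = \bigcup_b F b).
  apply: countable_bigcupT_measurable => [|b]; first exact: countableP.
  by apply: measurableX; exact: borel_measurable_ball.
apply/seteqP; split => [[y z] /= yz|[y z] [[n k] _ [/= ny nz]]]; last first.
  apply: le_lt_trans (@metric_triangle _ Y y (D n) z) _.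
  by rewrite metric_sym -(subrK (k.+1%:R^-1) r) addrC ltrD.
(* Half the gap: one 1 / (k + 1) pays for moving from [y] to the center, the other for the reduced
   radius. *)
have yz0 : 0 < (r - bdist y z) / 2 by rewrite divr_gt0// subr_gt0.
have [k] := ltr_add_invr yz0; rewrite add0r => k_lt.
have k0 : 0 < (k.+1%:R^-1 : R) by rewrite invr_gt0.
have [||x [yx [n _ nx]]] := dD (ball (y : Y) k.+1%:R^-1).
- by exists y; exact: ball_center (PosNum k0).
- exact: metric_ball_open.
have {}yx : mdist x y < k.+1%:R^-1 by move: yx; rewrite ballEmdist /= metric_sym.
exists (n, k) => //; split; rewrite /= /bdist nx//.
apply: le_lt_trans (@metric_triangle _ Y x y z) _.
rewrite -[@mdist _ Y y z]/(bdist y z).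
move: (k.+1%:R^-1 : R) (bdist y z) (@mdist _ Y x y) k_lt yx => e b c eb ce.
lra.
Qed.
End polish_borel.

(** * Randomized quantizers *)

Section soft_partition.
Local Open Scope ereal_scope.
Context (R : realType) d (Y : measurableType d) (mu : probability Y R).

(** A random choice of cell: [weight j y] is the probability that [y] is sent to [atom j]. Masses
    are positive because a point of cell [j] is redrawn with density [weight j / mass j]. *)
Record soft_partition := SoftPartition {
  cell :> finType ;
  weight : cell -> Y -> R ;
  atom : cell -> Y ;
  measurable_weight : forall j, measurable_fun setT (weight j) ;
  weight_ge0 : forall j y, (0 <= weight j y)%R ;
  weight_sum : forall y, (\sum_j weight j y = 1)%R ;
  mass_gt0 : forall j, 0 < \int[mu]_y (weight j y)%:E }.
End soft_partition.

Section soft_partition_theory.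
Local Open Scope ereal_scope.
Context (R : realType) d (Y : measurableType d) (mu : probability Y R).
Variable q : soft_partition mu.

Definition mass (j : cell q) : R := fine (\int[mu]_y (weight j y)%:E).

(* An upper bound for the density of the redrawn coordinate. *)
Definition cell_density (y : Y) : R := (\sum_j weight j y / mass j)%R.

Lemma weight_le1 (j : cell q) y : (weight j y <= 1)%R.
Proof.
rewrite -(weight_sum q y) (bigD1 j)//= lerDl sumr_ge0// => k _.
exact: weight_ge0.
Qed.

Lemma integral_weight_le1 (j : cell q) : \int[mu]_y (weight j y)%:E <= 1.
Proof.
rewrite -(@probability_setT _ _ _ mu) -[leRHS]mul1e -integral_cst//.
apply: ge0_le_integral => //.
- by move=> y _; rewrite lee_fin; exact: weight_ge0.
- apply/measurable_EFinP; exact: measurable_weight.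
- by move=> y _; rewrite lee_fin weight_le1.
Qed.

Lemma massE (j : cell q) : \int[mu]_y (weight j y)%:E = (mass j)%:E.
Proof.
rewrite fineK// ge0_fin_numE; last exact/ltW/mass_gt0.
exact: le_lt_trans (integral_weight_le1 j) (ltry _).
Qed.

Lemma mass_gt0R (j : cell q) : (0 < mass j)%R.
Proof. by rewrite -lte_fin -massE; exact: mass_gt0. Qed.

Lemma mass_le1 (j : cell q) : (mass j <= 1)%R.
Proof. by rewrite -lee_fin -massE; exact: integral_weight_le1. Qed.

Lemma measurable_cell_density : measurable_fun setT cell_density.
Proof.
apply: measurable_sum => j.
by apply: measurable_funM => //; exact: measurable_weight.
Qed.

(** Masses are at most 1, so dividing by them can only increase the sum of the weights. The bound
    keeps the arguments of [phi] in [1, +oo), where it is nonnegative. *)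
Lemma cell_density_ge1 y : (1 <= cell_density y)%R.
Proof.
rewrite -(weight_sum q y); apply: ler_sum => j _.
rewrite ler_peMr ?weight_ge0//.
by rewrite invf_ge1 ?mass_gt0R ?mass_le1.
Qed.

Lemma integral_cell_density : \int[mu]_y (cell_density y)%:E = #|cell q|%:R%:E.
Proof.
under eq_integral do rewrite /cell_density -sumEFin.
rewrite ge0_integral_sum//=.
- under eq_bigr => j _.
    under eq_integral do rewrite mulrC EFinM.
    rewrite ge0_integralZl//; last 3 first.
    + by apply/measurable_EFinP; exact: measurable_weight.
    + by move=> y _; rewrite lee_fin; exact: weight_ge0.
    + by rewrite lee_fin invr_ge0; exact/ltW/mass_gt0R.
    rewrite massE -EFinM mulVf ?gt_eqF ?mass_gt0R//.
    over.
  by rewrite sumEFin sumr_const.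
- move=> j; apply/measurable_EFinP; apply: measurable_funM => //.
  exact: measurable_weight.
- move=> j y _; rewrite lee_fin divr_ge0 ?weight_ge0//.
  exact/ltW/mass_gt0R.
Qed.

Lemma cell_density_le (n : R) : (forall j : cell q, n^-1 <= mass j)%R ->
  (0 < n)%R -> forall y, (cell_density y <= n)%R.
Proof.
move=> nm n0 y; rewrite -[leRHS]mulr1 -(weight_sum q y) mulr_sumr.
apply: ler_sum => j _; rewrite mulrC ler_wpM2r ?weight_ge0//.
by rewrite invf_ple ?posrE ?mass_gt0R.
Qed.
End soft_partition_theory.

(** * From a nearby finitely supported measure to a randomized quantizer *)

Section soft_quantization.
Local Open Scope ereal_scope.
Context (R : realType) (Y : polishType R).

(** Points of zero mass are dropped from the carrying set, so that every remaining atom gives a cell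
    of positive mass. *)
Lemma finitely_supported_atoms n (nu : probability (borel Y) R) :
  finitely_supported n nu -> exists s : seq (borel Y),
  [/\ uniq s, (size s <= n)%N, forall y, y \in s -> 0 < nu [set y] &
   forall B, measurable B -> nu B = \sum_(y <- s) nu [set y] * \d_y B].
Proof.
move=> [A An nuA].
have finA : finite_set A by apply/finite_set_leP; exists n.
pose F := finmap.enum_fset (fset_set A).
have mset1 (y : borel Y) : measurable [set y] by exact: borel_measurable_set1.
have mA : measurable A by exact: borel_measurable_finite.
have nuB B : measurable B -> nu B = \sum_(y <- F) nu [set y] * \d_y B.
  move=> mB; have -> : nu B = nu (B `&` A).
    rewrite -[B in LHS](setUIDK B A) measureU//; last 3 first.
    - exact: measurableI.
    - exact: measurableD.
    - by rewrite setDE setIACA setICr setI0.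
    rewrite [X in _ + X](_ : _ = 0) ?adde0//.
    apply/eqP; rewrite eq_le measure_ge0 andbT.
    rewrite (@le_trans _ _ (nu (~` A)))//.
      apply: le_measure; rewrite ?inE; [exact: measurableD|exact: measurableC|].
      by move=> y [].
    by rewrite probability_setC// nuA -EFinB subrr.
  have -> : B `&` A = \big[setU/set0]_(y \in A) (B `&` [set y]).
    rewrite fsbig_setU// -setI_bigcupr; congr (_ `&` _).
    by apply/seteqP; split => [y Ay|y [z Az ->]//]; exists y.
  rewrite measure_fsbig//; last 2 first.
  - by move=> y _; exact: measurableI.
  - by move=> y z _ _ [x [[_ ->] [_ ->]]].
  rewrite fsbig_finite//=; apply: eq_bigr => y _.
  rewrite diracE; case: (asboolP (B y)) => By.
    rewrite mem_set// mule1; congr (nu _).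
    by apply/seteqP; split => [z []//|z /= ->].
  rewrite memNset// mule0 (_ : _ `&` _ = set0) ?measure0//.
  by apply/seteqP; split => [z [Bz /= zy]|//]; apply: By; rewrite -zy.
exists [seq y <- F | nu [set y] != 0]; split.
- by rewrite filter_uniq// finmap.fset_uniq.
- rewrite size_filter (leq_trans (count_size _ _))//.
  exact: geq_card_fset_set.
- by move=> y; rewrite mem_filter => /andP[y0 _]; rewrite lt0e y0 measure_ge0.
- move=> B mB; rewrite nuB// big_filter [RHS]big_mkcond/=; apply: eq_bigr => y _.
  by case: eqP => //= ->; rewrite mul0e.
Qed.

(** An infimum strictly below a bound is beaten by some plan; the strictness replaces the existence
    of an optimal plan. *)
Lemma wasserstein_lt d (T : measurableType d) (dist : T -> T -> R) (p t : R)
    (mu nu : probability T R) : (0 < p)%R ->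
  wasserstein dist p mu nu < t%:E ->
  exists2 kappa, plans mu nu kappa &
    \int[kappa]_z (dist z.1 z.2 `^ p)%:E < (t `^ p)%:E.
Proof.
move=> p0 Wt.
have t0 : (0 <= t)%R.
  by rewrite -lee_fin (le_trans _ (ltW Wt))// poweR_ge0.
apply: contrapT => nex; move: Wt; apply/negP; rewrite -leNgt.
have -> : t%:E = ((t `^ p)%:E `^ p^-1).
  by rewrite poweR_EFin -powRrM mulfV ?gt_eqF// powRr1.
apply: gt0_ler_poweR.
- by rewrite invr_ge0 ltW.
- by rewrite in_itv/= leey andbT lee_fin powR_ge0.
- rewrite in_itv/= leey andbT; apply: le_ereal_inf_tmp => _ [k _ <-].
  by apply: integral_ge0 => z _; rewrite lee_fin powR_ge0.
- apply: le_ereal_inf_tmp => _ [k kp <-]; rewrite leNgt; apply/negP => klt.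
  by apply: nex; exists k.
Qed.

Lemma measurable_bdist_powR (y : borel Y) (p : R) :
  measurable_fun setT (fun z : borel Y => bdist y z `^ p)%R.
Proof.
apply: (measurableT_comp (measurable_powR p)).
by apply: measurable_fun_lt => r; exact: borel_measurable_ball.
Qed.

Lemma soft_quantization (p t : R) n (mu nu : probability (borel Y) R) :
  (0 < p)%R -> finitely_supported n nu ->
  wasserstein (@bdist R Y) p nu mu < t%:E ->
  exists q : soft_partition mu, [/\ (#|cell q| <= n)%N,
    forall B, measurable B -> nu B = \sum_(j : cell q) (mass j)%:E * \d_(atom j) B,
    \sum_(j : cell q) \int[mu]_y
      ((weight j y)%:E * (bdist (atom j) y `^ p)%:E) <= (t `^ p)%:E &
    empirical n nu -> forall j : cell q, (n%:R^-1 <= mass j)%R].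
Proof.
move=> p0 fs /(wasserstein_lt p0)[kappa kp kt].
have [s [us sn s0 sE]] := finitely_supported_atoms fs.
have mset1 (y : borel Y) : measurable [set y] by exact: borel_measurable_set1.
pose a (j : 'I_(size s)) : borel Y := nth point s j.
have as_ j : a j \in s by exact: mem_nth.
have big_s (V : nmodType) (F : borel Y -> V) :
    (\sum_(y <- s) F y = \sum_j F (a j))%R.
  by rewrite (big_nth point) big_mkord.
(* The events [z.1 = a j] partition the plan up to a null set, because [nu] is carried by [s].
   Conditioning them on the second coordinate produces the weights. *)
pose e (j : 'I_(size s)) (z : borel Y * borel Y) : R := \1_[set a j] z.1.
have me j : measurable_fun setT (e j).
  by apply: (measurable_indic_comp (xi := fst)).
have e01 j z : (0 <= e j z <= 1)%R.
  by rewrite /e indicE; case: (_ \in _); rewrite ?lexx ?ler01.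
have s_e1 z : z.1 \in s -> (\sum_j e j z = 1)%R.
  move=> zs; rewrite -(big_s _ (fun y => \1_[set y] z.1)) (bigD1_seq z.1)//=.
  rewrite indicE mem_set//= big1 ?addr0// => y yz.
  by rewrite indicE memNset//= => zy; rewrite zy eqxx in yz.
have mC : measurable [set` s].
  rewrite (_ : [set` s] = \big[setU/set0]_(y <- s) [set y]).
    exact: bigsetU_measurable.
  rewrite -bigcup_seq; apply/seteqP.
  by split => [y ys|y [z zs ->]//]; exists y.
have nuC : nu [set` s] = 1.
  rewrite -(@probability_setT _ _ _ nu) sE// [RHS]sE//.
  apply: eq_big_seq => y ys; rewrite !diracE !mem_set//.
have e1 : {ae kappa, forall z, (\sum_j e j z = 1)%R}.
  exists ((~` [set` s]) `*` setT); split.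
  - by apply: measurableX => //; exact: measurableC.
  - rewrite (kp _ (measurableC mC)).1.
    by rewrite probability_setC// nuC -EFinB subrr.
  - move=> z /= ze; split => //= zs.
    by apply: ze; exact: s_e1.
have s_gt0 : (0 < size s)%N.
  rewrite lt0n; apply/eqP => /size0nil s_nil.
  have := @probability_setT _ _ _ nu; rewrite sE// s_nil big_nil.
  by move/eqP; rewrite eq_sym onee_eq0.
pose j0 := Ordinal s_gt0.
have kappa2 B : measurable B -> kappa (snd @^-1` B) = mu B.
  move=> mB; rewrite -(kp _ mB).2; congr (kappa _).
  by apply/seteqP; split => z //= [].
have [w [mw w0 w1 wE]] := conditional_partition
  (measurable_snd : measurable_fun setT (snd : borel Y * borel Y -> borel Y))
  kappa2 j0 me e01 e1.
have wmass j : \int[mu]_y (w j y)%:E = nu [set a j].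
  transitivity (\int[mu]_y ((w j y)%:E * cst 1 y)).
    by apply: eq_integral => y _; rewrite mule1.
  rewrite wE//.
  transitivity (\int[kappa]_z (\1_([set a j] `*` setT) z)%:E).
    apply: eq_integral => z _; rewrite mule1 /e !indicE; congr ((nat_of_bool _)%:R%:E).
    by apply/idP/idP; rewrite !inE => // -[].
  rewrite integral_indicT; last exact: measurableX.
  exact: (kp _ (mset1 (a j))).1.
have q0 j : 0 < \int[mu]_y (w j y)%:E by rewrite wmass s0.
pose q := SoftPartition a mw w0 w1 q0.
have qm (j : cell q) : nu [set a j] = (mass j)%:E by rewrite -massE wmass.
exists q; split.
- by rewrite card_ord.
- by move=> B mB; rewrite sE// big_s; apply: eq_bigr => j _; rewrite qm.
- have ma j : measurable_fun setT (fun y => (bdist (a j) y `^ p)%:E).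
    by apply/measurable_EFinP; exact: measurable_bdist_powR.
  have d0 j y : 0 <= (bdist (a j) y `^ p)%:E by rewrite lee_fin powR_ge0.
  rewrite (eq_bigr (fun j => \int[kappa]_z
      ((e j z)%:E * (bdist (a j) z.2 `^ p)%:E))); last first.
    by move=> j _; exact: (wE j (fun y => (bdist (a j) y `^ p)%:E)).
  rewrite -ge0_integral_sum//=; last 2 first.
  + move=> j; apply: emeasurable_funM; first exact/measurable_EFinP.
    exact: (measurableT_comp (ma j)).
  + move=> j z _; rewrite mule_ge0// lee_fin.
    by case/andP: (e01 j z).
  apply: le_trans (ltW kt); apply: ge0_le_integral => //.
  + move=> z _; apply: sume_ge0 => j _; rewrite mule_ge0// lee_fin.
    by case/andP: (e01 j z).
  + apply: emeasurable_sum => j; apply: emeasurable_funM.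
      exact/measurable_EFinP.
    exact: (measurableT_comp (ma j)).
  + apply/measurable_EFinP; apply: (measurableT_comp (measurable_powR _)).
    exact: measurable_bdist.
  (* Term [j] only sees the pairs with first coordinate [a j], where the distance from the atom is
     the transported distance. *)
  + move=> z _; apply: (@le_trans _ _
        (\sum_j (e j z)%:E * (bdist z.1 z.2 `^ p)%:E)).
      apply: lee_sum => j _; rewrite /e indicE.
      by have [/set_mem ->|] := boolP (z.1 \in _); rewrite ?mul0e.
    rewrite -ge0_sume_distrl; last first.
      by move=> j _; rewrite lee_fin; case/andP: (e01 j z).
    rewrite sumEFin; have [zs|zs] := boolP (z.1 \in s).
      by rewrite s_e1// mul1e.
    rewrite big1 ?mul0e ?lee_fin ?powR_ge0// => j _.
    rewrite /e indicE memNset//= => za.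
    by move: zs; rewrite za as_.
(* An atom of positive mass is one of the points [y i], and each occurrence contributes 1 / n;
   repetitions only add to the mass. *)
- move=> [y nuy] j; rewrite -lee_fin -qm nuy//.
  have [i yia] : exists i, y i = a j.
    apply: contrapT => nya; have := s0 _ (as_ j).
    rewrite nuy// big1 ?mule0 ?ltxx// => i _.
    by rewrite diracE memNset//= => yia; apply: nya; exists i.
  rewrite -[leLHS]mule1 lee_wpmul2l ?lee_fin ?invr_ge0//.
  rewrite (bigD1 i)//= diracE mem_set//= leeDl//.
  by apply: sume_ge0 => k _; exact: measure_ge0.
Qed.
End soft_quantization.

(** * Redrawing a coordinate and resampling along a quantizer *)

Section coordinates.
Context (I : finType) (d : I -> measure_display)
  (T : forall i, measurableType (d i)).

Definition upd (x : mprod T) i (z : T i) : mprod T := mprod_upd (x, z).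

Lemma updE x i (z : T i) : upd x z i = z.
Proof. by rewrite /upd /mprod_upd /= dfwithin. Qed.

Lemma upd_neq x i (z : T i) k : k != i -> upd x z k = x k.
Proof. by move=> ki; rewrite /upd /mprod_upd /= dfwithout// eq_sym. Qed.

Lemma measurable_coord i : measurable_fun setT (fun x : mprod T => x i).
Proof. by move=> _ A mA; rewrite setTI; exact: measurable_proj. Qed.

Lemma measurable_upd d' (S : measurableType d') i (f : S -> mprod T) (g : S -> T i) :
  measurable_fun setT f -> measurable_fun setT g ->
  measurable_fun setT (fun s => upd (f s) (g s)).
Proof.
move=> mf mg; apply: (measurableT_comp (@measurable_mprod_upd I d T i)).
exact: measurable_fun_pair.
Qed.
End coordinates.

Lemma integral_redraw (R : realType) (I : finType) (d : I -> measure_display)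
    (T : forall i, measurableType (d i)) (nu : probability (mprod T) R) i
    (m : probability (T i) R) (g : mprod T -> \bar R) :
  measurable_fun setT g -> (forall x, 0 <= g x)%E ->
  (\int[redraw nu m]_x g x = \int[nu]_x \int[m]_z g (upd x z))%E.
Proof.
move=> mg g0; rewrite ge0_integral_pushforward//.
  rewrite preimage_setT fubini_tonelli1//=.
exact: (measurableT_comp mg (@measurable_mprod_upd I d T i)).
Qed.

Section resample.
Local Open Scope ereal_scope.
Context (R : realType) (I : finType) (d : I -> measure_display)
  (T : forall i, measurableType (d i)).

(* A state [(x, (y, v))]: the point drawn from [pi], its quantized version, and
   its resampled version, the coordinates being treated one at a time. *)
Let state := (mprod T * (mprod T * mprod T))%type.

Section step.
Variables (rho : probability state R) (i : I) (m : probability (T i) R).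
Variable q : soft_partition m.
Hypothesis rho_i : forall g, measurable_fun setT g -> (forall x, 0 <= g x) ->
  \int[rho]_w g (w.1 i) = \int[m]_z g z.

(** With [b] distributed as [rho \x m], the first factor selects the cell of the source coordinate
    and the second is the density, against the fixed measure [m], of a redraw within that cell. *)
Let h (j : cell q) (b : state * T i) : R :=
  (weight j (b.1.1 i) * (weight j b.2 / mass j))%R.

Let F (j : cell q) (b : state * T i) : state :=
  (b.1.1, (upd b.1.2.1 (atom j), upd b.1.2.2 b.2)).

Let mwx (j : cell q) : measurable_fun setT (fun w : state => weight j (w.1 i)).
Proof.
apply: (measurableT_comp (measurable_weight j)).
exact: (measurableT_comp (@measurable_coord I d T i) measurable_fst).
Qed.

Let mh j : measurable_fun setT (h j).
Proof.
apply: measurable_funM.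
  exact: (measurableT_comp (mwx j) measurable_fst).
apply: measurable_funM => //.
exact: (measurableT_comp (measurable_weight j) measurable_snd).
Qed.

Let mF j : measurable_fun setT (F j).
Proof.
have mx : measurable_fun setT (fun b : state * T i => b.1.1).
  exact: (measurableT_comp measurable_fst measurable_fst).
have m2 : measurable_fun setT (fun b : state * T i => b.1.2).
  exact: (measurableT_comp measurable_snd measurable_fst).
apply: measurable_fun_pair => //; apply: measurable_fun_pair => /=.
  by apply: measurable_upd => //; exact: (measurableT_comp measurable_fst m2).
by apply: measurable_upd => //; exact: (measurableT_comp measurable_snd m2).
Qed.

Let h0 j b : (0 <= h j b)%R.
Proof.
rewrite mulr_ge0 ?weight_ge0// divr_ge0 ?weight_ge0//.
exact/ltW/mass_gt0R.
Qed.

Let integral_share (j : cell q) : \int[m]_z (weight j z / mass j)%:E = 1.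
Proof.
under eq_integral do rewrite mulrC EFinM.
rewrite ge0_integralZl//; last 3 first.
- by apply/measurable_EFinP; exact: measurable_weight.
- by move=> y _; rewrite lee_fin; exact: weight_ge0.
- by rewrite lee_fin invr_ge0; exact/ltW/mass_gt0R.
by rewrite massE -EFinM mulVf ?gt_eqF ?mass_gt0R.
Qed.

Let integral_share_cst (j : cell q) (a : R) (c : \bar R) : (0 <= a)%R -> 0 <= c ->
  \int[m]_z ((a * (weight j z / mass j))%:E * c) = a%:E * c.
Proof.
move=> a0 c0; under eq_integral do rewrite EFinM muleAC.
rewrite ge0_integralZl//.
- by rewrite integral_share mule1.
- apply/measurable_EFinP; apply: measurable_funM => //.
  exact: measurable_weight.
- move=> y _; rewrite lee_fin divr_ge0 ?weight_ge0//; exact/ltW/mass_gt0R.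
- by rewrite mule_ge0// lee_fin.
Qed.

Lemma resample_step : exists rho' : probability state R, forall G,
  measurable_fun setT G -> (forall w, 0 <= G w) ->
  \int[rho']_w G w = \sum_(j : cell q) \int[rho]_w \int[m]_z
    ((weight j (w.1 i) * (weight j z / mass j))%:E *
     G (w.1, (upd w.2.1 (atom j), upd w.2.2 z))).
Proof.
have [|rho' rho'E] := @mixture_probability R _ _ _ _ (rho \x m) (cell q) h F mh mF h0.
  transitivity (\sum_(j : cell q) \int[rho]_w (weight j (w.1 i))%:E).
    apply: eq_bigr => j _.
    have mhE : measurable_fun setT (EFin \o h j) by exact/measurable_EFinP.
    have hE0 b : 0 <= (EFin \o h j) b by rewrite lee_fin.
    rewrite (fubini_tonelli1 (m1 := rho) (m2 := m) _ mhE hE0).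
    apply: eq_integral => w _; rewrite /fubini_F /h /=.
    under eq_integral do rewrite -[(_ * _)%:E]mule1.
    by rewrite integral_share_cst ?mule1 ?weight_ge0.
  rewrite -ge0_integral_sum//=.
  - under eq_integral do rewrite sumEFin weight_sum.
    by rewrite integral_cst// mul1e; exact: probability_setT.
  - by move=> j; exact/measurable_EFinP.
  - by move=> j w _; rewrite lee_fin weight_ge0.
exists rho' => G mG G0; rewrite rho'E//; apply: eq_bigr => j _.
rewrite (fubini_tonelli1 (m1 := rho) (m2 := m)
  (fun b => (h j b)%:E * G (F j b)))//.
- apply: emeasurable_funM; first exact/measurable_EFinP.
  exact: (measurableT_comp mG (mF j)).
- by move=> b; rewrite mule_ge0// lee_fin.
Qed.

Variable rho' : probability state R.
Hypothesis rho'E : forall G, measurable_fun setT G -> (forall w, 0 <= G w) ->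
  \int[rho']_w G w = \sum_(j : cell q) \int[rho]_w \int[m]_z
    ((weight j (w.1 i) * (weight j z / mass j))%:E *
     G (w.1, (upd w.2.1 (atom j), upd w.2.2 z))).

(** Integrating out the redraw and summing over the cells leaves total weight 1. This preserves what
    was established for the other coordinates. *)
Lemma resample_invariant (G : state -> \bar R) : measurable_fun setT G -> (forall w, 0 <= G w) ->
  (forall w (y z : T i), G (w.1, (upd w.2.1 y, upd w.2.2 z)) = G w) ->
  \int[rho']_w G w = \int[rho]_w G w.
Proof.
move=> mG G0 GE; rewrite rho'E//.
transitivity (\sum_(j : cell q) \int[rho]_w ((weight j (w.1 i))%:E * G w)).
  apply: eq_bigr => j _; apply: eq_integral => w _.
  under eq_integral do rewrite GE.
  by rewrite integral_share_cst ?weight_ge0.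
rewrite -ge0_integral_sum//=.
- apply: eq_integral => w _.
  rewrite -ge0_sume_distrl; last by move=> j _; rewrite lee_fin weight_ge0.
  by rewrite sumEFin weight_sum mul1e.
- by move=> j; apply: emeasurable_funM => //; exact/measurable_EFinP.
- by move=> j w _; rewrite mule_ge0// lee_fin weight_ge0.
Qed.

Lemma resample_atom (G : state -> \bar R) (g : T i -> T i -> \bar R) :
  measurable_fun setT G -> (forall w, 0 <= G w) ->
  (forall y, measurable_fun setT (g y)) -> (forall y x, 0 <= g y x) ->
  (forall w (y z : T i), G (w.1, (upd w.2.1 y, upd w.2.2 z)) = g y (w.1 i)) ->
  \int[rho']_w G w =
  \sum_(j : cell q) \int[m]_z ((weight j z)%:E * g (atom j) z).
Proof.
move=> mG G0 mg g0 GE; rewrite rho'E//; apply: eq_bigr => j _.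
transitivity (\int[rho]_w ((weight j (w.1 i))%:E * g (atom j) (w.1 i))).
  apply: eq_integral => w _; under eq_integral do rewrite GE.
  by rewrite integral_share_cst ?weight_ge0.
rewrite (rho_i (g := fun z => (weight j z)%:E * g (atom j) z))//.
- by apply: emeasurable_funM => //; apply/measurable_EFinP; exact: measurable_weight.
- by move=> z; rewrite mule_ge0// lee_fin weight_ge0.
Qed.

(** Given cell [j], the source coordinate and the redraw are independent with the same law, of
    density [weight j / mass j]; hence the right-hand side is that of [resample_atom]. The factor
    [mass j] from integrating the selection weight cancels the normalization. *)
Lemma resample_draw (G : state -> \bar R) (g : T i -> T i -> \bar R) :
  measurable_fun setT G -> (forall w, 0 <= G w) ->
  (forall y, measurable_fun setT (g y)) -> (forall y x, 0 <= g y x) ->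
  (forall w (y z : T i), G (w.1, (upd w.2.1 y, upd w.2.2 z)) = g y z) ->
  \int[rho']_w G w =
  \sum_(j : cell q) \int[m]_z ((weight j z)%:E * g (atom j) z).
Proof.
move=> mG G0 mg g0 GE; rewrite rho'E//; apply: eq_bigr => j _.
set c := \int[m]_z ((weight j z)%:E * g (atom j) z).
have c0 : 0 <= c by apply: integral_ge0 => z _; rewrite mule_ge0// lee_fin weight_ge0.
transitivity (\int[rho]_w ((weight j (w.1 i))%:E * ((mass j)^-1%:E * c))).
  apply: eq_integral => w _; under eq_integral do rewrite GE.
  rewrite muleA -EFinM -ge0_integralZl//.
  - apply: eq_integral => z _; rewrite muleA -EFinM; congr (_%:E * _).
    by rewrite mulrA mulrAC.
  - apply: emeasurable_funM => //; apply/measurable_EFinP; exact: measurable_weight.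
  - by move=> z _; rewrite mule_ge0// lee_fin weight_ge0.
  - rewrite lee_fin mulr_ge0 ?weight_ge0// invr_ge0; exact/ltW/mass_gt0R.
rewrite ge0_integralZr//.
- rewrite (rho_i (g := fun z => (weight j z)%:E)).
  + by rewrite massE muleA -EFinM mulfV ?mul1e// gt_eqF ?mass_gt0R.
  + by apply/measurable_EFinP; exact: measurable_weight.
  + by move=> z; rewrite lee_fin weight_ge0.
- exact/measurable_EFinP.
- by move=> w _; rewrite lee_fin weight_ge0.
- by rewrite mule_ge0// lee_fin invr_ge0; exact/ltW/mass_gt0R.
Qed.

(* The bound drops the factor [weight j (w.1 i) <= 1]. *)
Lemma resample_domination (g : mprod T -> \bar R) :
  measurable_fun setT g -> (forall x, 0 <= g x) ->
  \int[rho']_w g w.2.2 <=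
  \int[rho]_w \int[m]_z ((cell_density q z)%:E * g (upd w.2.2 z)).
Proof.
move=> mg g0.
have mgv : measurable_fun setT (fun w : state => g w.2.2).
  apply: (measurableT_comp mg).
  exact: (measurableT_comp measurable_snd measurable_snd).
have mgu : measurable_fun setT (fun b : state * T i => g (upd b.1.2.2 b.2)).
  apply: (measurableT_comp mg); apply: measurable_upd => //.
  apply: (measurableT_comp measurable_snd).
  exact: (measurableT_comp measurable_snd measurable_fst).
have mhg j : measurable_fun setT (fun b => (h j b)%:E * g (upd b.1.2.2 b.2)).
  by apply: emeasurable_funM => //; exact/measurable_EFinP.
have hg0 j b : 0 <= (h j b)%:E * g (upd b.1.2.2 b.2).
  by rewrite mule_ge0// lee_fin.
have mdg : measurable_fun setT
    (fun b : state * T i => (cell_density q b.2)%:E * g (upd b.1.2.2 b.2)).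
  apply: emeasurable_funM => //; apply/measurable_EFinP.
  exact: (measurableT_comp (measurable_cell_density q) measurable_snd).
have dg0 (b : state * T i) : 0 <= (cell_density q b.2)%:E * g (upd b.1.2.2 b.2).
  by rewrite mule_ge0// lee_fin (le_trans ler01)// cell_density_ge1.
rewrite (rho'E (G := fun w => g w.2.2))//=.
rewrite -(fubini_tonelli1 (m1 := rho) (m2 := m) _ mdg dg0).
under eq_bigr do rewrite -(fubini_tonelli1 (m1 := rho) (m2 := m) _ (mhg _) (hg0 _)).
rewrite -ge0_integral_sum//; apply: ge0_le_integral => //.
- by move=> b _; apply: sume_ge0 => j _.
- exact: emeasurable_sum.
- move=> b _; rewrite -ge0_sume_distrl; last by move=> j _; rewrite lee_fin.
  rewrite lee_wpmul2r// sumEFin lee_fin; apply: ler_sum => j _.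
  rewrite ler_piMl ?weight_le1// divr_ge0 ?weight_ge0//.
  exact/ltW/mass_gt0R.
Qed.
End step.

Variables (mu : forall i, probability (T i) R) (q : forall i, soft_partition (mu i)).
Variable D : forall i, T i -> T i -> \bar R.
Hypothesis mD : forall i, measurable_fun setT (fun z : T i * T i => D z.1 z.2).
Hypothesis D0 : forall i (y x : T i), 0 <= D y x.
Hypothesis Dxx : forall i (x : T i), D x x = 0.
Variable pi : probability (mprod T) R.
Hypothesis pi_mu : forall i g, measurable_fun setT g -> (forall x, 0 <= g x) ->
  \int[pi]_x g (x i) = \int[mu i]_z g z.

Definition cell_cost i := \sum_(j : cell (q i))
  \int[mu i]_z ((weight j z)%:E * D (atom j) z).

Definition redraws (s : seq I) : probability (mprod T) R :=
  foldr (fun i nu => redraw nu (mu i)) pi s.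

Definition densities (s : seq I) (x : mprod T) : R :=
  (\prod_(i <- s) cell_density (q i) (x i))%R.

(** The invariant of the induction over the treated coordinates [s]. The source keeps its law [pi],
    so that the next coordinate still has law [mu i]. Only the domination concerns the joint law of
    the resampled point, and its reference measure [redraws s] is not yet the product. *)
Record resampled (s : seq I) (rho : probability state R) : Prop := Resampled {
  resampled_source : forall g, measurable_fun setT g -> (forall x, 0 <= g x) ->
    \int[rho]_w g w.1 = \int[pi]_x g x ;
  resampled_target : forall k g, measurable_fun setT g -> (forall x, 0 <= g x) ->
    \int[rho]_w g (w.2.2 k) = \int[mu k]_z g z ;
  resampled_atoms : forall k g, measurable_fun setT g -> (forall x, 0 <= g x) ->
    \int[rho]_w g (w.2.1 k) =
    if k \in s then \sum_(j : cell (q k)) (mass j)%:E * g (atom j)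
    else \int[mu k]_z g z ;
  resampled_source_cost : forall k,
    \int[rho]_w D (w.2.1 k) (w.1 k) = if k \in s then cell_cost k else 0 ;
  resampled_target_cost : forall k,
    \int[rho]_w D (w.2.1 k) (w.2.2 k) = if k \in s then cell_cost k else 0 ;
  resampled_domination : forall g, measurable_fun setT g -> (forall x, 0 <= g x) ->
    \int[rho]_w g w.2.2 <= \int[redraws s]_x ((densities s x)%:E * g x) }.

Let mproj1 k : measurable_fun setT (fun w : state => w.1 k).
Proof. exact: (measurableT_comp (@measurable_coord I d T k) measurable_fst). Qed.

Let m21 : measurable_fun setT (fun w : state => w.2.1).
Proof. exact: (measurableT_comp measurable_fst measurable_snd). Qed.

Let m22 : measurable_fun setT (fun w : state => w.2.2).
Proof. exact: (measurableT_comp measurable_snd measurable_snd). Qed.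

Let mproj21 k : measurable_fun setT (fun w : state => w.2.1 k).
Proof. exact: (measurableT_comp (@measurable_coord I d T k) m21). Qed.

Let mproj22 k : measurable_fun setT (fun w : state => w.2.2 k).
Proof. exact: (measurableT_comp (@measurable_coord I d T k) m22). Qed.

Let mcoord k (g : T k -> \bar R) (f : state -> mprod T) :
  measurable_fun setT f -> measurable_fun setT g ->
  measurable_fun setT (fun w => g (f w k)).
Proof.
move=> mf mg.
have mfk : measurable_fun setT (fun w : state => f w k).
  exact: (measurableT_comp (@measurable_coord I d T k) mf).
exact: (measurableT_comp (f := g) mg mfk).
Qed.

Let mDcomp k (f g : state -> T k) : measurable_fun setT f ->
  measurable_fun setT g -> measurable_fun setT (fun w => D (f w) (g w)).
Proof.
move=> mf mg; apply: (measurableT_comp (@mD k) (measurable_fun_pair mf mg)).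
Qed.

Lemma densities_ge1 s x : (1 <= densities s x)%R.
Proof.
rewrite /densities; elim/big_rec : _ => [|i y _ y1]; first exact: lexx.
by rewrite -[leLHS]mulr1 ler_pM// cell_density_ge1.
Qed.

Lemma measurable_densities s : measurable_fun setT (densities s).
Proof.
rewrite /densities; elim: s => [|i s IH].
  under eq_fun do rewrite big_nil.
  exact: measurable_cst.
under eq_fun do rewrite big_cons.
apply: measurable_funM => //.
exact: (measurableT_comp (measurable_cell_density (q i)) (@measurable_coord I d T i)).
Qed.

Lemma resampled_nil : exists rho, resampled [::] rho.
Proof.
have mdiag : measurable_fun setT (fun x : mprod T => (x, (x, x)) : state).
  by apply: measurable_fun_pair => //; exact: measurable_fun_pair.
have [rho rhoE] := law_exists pi mdiag.
exists rho; split => /=.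
- move=> g mg g0; rewrite (rhoE (fun w => g w.1))//.
  exact: (measurableT_comp mg measurable_fst).
- move=> k g mg g0; rewrite (rhoE (fun w => g (w.2.2 k)))/= ?pi_mu//.
  exact: (mcoord m22 mg).
- move=> k g mg g0; rewrite (rhoE (fun w => g (w.2.1 k)))/= ?pi_mu//.
  exact: (mcoord m21 mg).
- move=> k; rewrite (rhoE (fun w => D (w.2.1 k) (w.1 k)))//=; last exact: mDcomp.
  by under eq_integral do rewrite Dxx; rewrite integral0.
- move=> k; rewrite (rhoE (fun w => D (w.2.1 k) (w.2.2 k)))//=; last exact: mDcomp.
  by under eq_integral do rewrite Dxx; rewrite integral0.
- move=> g mg g0; rewrite (rhoE (fun w => g w.2.2))//=; last first.
    exact: (measurableT_comp mg m22).
  rewrite le_eqVlt; apply/orP; left; apply/eqP; apply: eq_integral => x _.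
  by rewrite /densities big_nil mul1e.
Qed.

Lemma resampled_cons i s rho : i \notin s -> resampled s rho ->
  exists rho', resampled (i :: s) rho'.
Proof.
move=> iNs [src tgt atm srcD tgtD dom].
have rho_i g : measurable_fun setT g -> (forall x, 0 <= g x) ->
    \int[rho]_w g (w.1 i) = \int[mu i]_z g z.
  move=> mg g0; rewrite -pi_mu// (src (fun x => g (x i)))//.
  exact: (measurableT_comp mg (@measurable_coord I d T i)).
have [rho' rho'E] := @resample_step rho i (mu i) (q i).
have mDy (y : T i) : measurable_fun setT (fun z => D y z).
  have m2 : measurable_fun setT (fun z : T i => (y, z)).
    exact: measurable_fun_pair.
  exact: (measurableT_comp (@mD i) m2).
exists rho'; split.
- move=> g mg g0; rewrite (resample_invariant rho'E (G := fun w => g w.1))//.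
    exact: src.
  exact: (measurableT_comp mg measurable_fst).
- move=> k g mg g0; have mG := mcoord m22 mg.
  have [ki|ki] := eqVneq k i; last first.
    rewrite (resample_invariant rho'E (G := fun w => g (w.2.2 k)))//; first exact: tgt.
    by move=> w y z /=; rewrite upd_neq.
  subst k; rewrite (resample_draw rho_i rho'E (G := fun w => g (w.2.2 i))
    (g := fun y z => g z))//.
  + rewrite -ge0_integral_sum//.
    * apply: eq_integral => z _; rewrite -ge0_sume_distrl.
        by rewrite sumEFin weight_sum mul1e.
      by move=> j _; rewrite lee_fin weight_ge0.
    * move=> j; apply: emeasurable_funM => //; apply/measurable_EFinP.
      exact: measurable_weight.
    * by move=> j z _; rewrite mule_ge0// lee_fin weight_ge0.
  + by move=> w y z /=; rewrite updE.
- move=> k g mg g0; have mG := mcoord m21 mg.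
  rewrite in_cons; have [ki|ki] /= := eqVneq k i; last first.
    rewrite (resample_invariant rho'E (G := fun w => g (w.2.1 k)))//; first exact: atm.
    by move=> w y z /=; rewrite upd_neq.
  subst k; rewrite (resample_atom rho_i rho'E (G := fun w => g (w.2.1 i))
    (g := fun y z => g y))//.
  + apply: eq_bigr => j _; rewrite ge0_integralZr//.
    * by rewrite massE.
    * by apply/measurable_EFinP; exact: measurable_weight.
    * by move=> z _; rewrite lee_fin weight_ge0.
  + by move=> w y z /=; rewrite updE.
- move=> k; rewrite in_cons; have [ki|ki] /= := eqVneq k i; last first.
    rewrite (resample_invariant rho'E (G := fun w => D (w.2.1 k) (w.1 k)))//.
    * exact: mDcomp.
    * by move=> w y z /=; rewrite upd_neq.
  subst k; rewrite (resample_atom rho_i rho'E (G := fun w => D (w.2.1 i) (w.1 i))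
    (g := @D i))//.
  + exact: mDcomp.
  + by move=> w y z /=; rewrite updE.
- move=> k; rewrite in_cons; have [ki|ki] /= := eqVneq k i; last first.
    rewrite (resample_invariant rho'E (G := fun w => D (w.2.1 k) (w.2.2 k)))//.
    * exact: mDcomp.
    * by move=> w y z /=; rewrite !upd_neq.
  subst k; rewrite (resample_draw rho_i rho'E (G := fun w => D (w.2.1 i) (w.2.2 i))
    (g := @D i))//.
  + exact: mDcomp.
  + by move=> w y z /=; rewrite !updE.
- move=> g mg g0; apply: le_trans (resample_domination rho'E mg g0) _.
  (* Averaging [f] over the new coordinate gives a function of the previous resampled point, to
     which the domination for [s] applies. *)
  pose f (b : mprod T * T i) := (cell_density (q i) b.2)%:E * g (upd b.1 b.2).
  have f0 b : 0 <= f b.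
    by rewrite mule_ge0// lee_fin (le_trans ler01)// cell_density_ge1.
  have mf : measurable_fun setT f.
    apply: emeasurable_funM.
      apply/measurable_EFinP.
      exact: (measurableT_comp (measurable_cell_density (q i)) measurable_snd).
    by apply: (measurableT_comp mg); exact: measurable_upd.
  have mF := measurable_fun_fubini_tonelli_F (m2 := mu i) f mf f0.
  have F0 x : 0 <= \int[mu i]_z f (x, z) by exact: integral_ge0.
  apply: le_trans (dom _ mF F0) _; rewrite /redraws /=.
  rewrite (@integral_redraw _ _ _ _ _ _ _ (fun x => (densities (i :: s) x)%:E * g x)).
  + rewrite le_eqVlt; apply/orP; left; apply/eqP; apply: eq_integral => x _.
    rewrite -ge0_integralZl//.
    * apply: eq_integral => z _; rewrite /f /= muleA -EFinM; congr (_%:E * _).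
      (* As [i] is not in [s], the update at [i] leaves the previous factors unchanged. *)
      rewrite /densities big_cons updE mulrC; congr (_ * _)%R.
      apply: eq_big_seq => k ks; rewrite upd_neq//.
      by apply: contraNneq iNs => <-.
    * apply: (measurableT_comp mf).
      exact: measurable_fun_pair.
    * by rewrite lee_fin (le_trans ler01)// densities_ge1.
  + by apply: emeasurable_funM => //; apply/measurable_EFinP; exact: measurable_densities.
  + by move=> x; rewrite mule_ge0// lee_fin (le_trans ler01)// densities_ge1.
Qed.

Lemma resampled_exists s : uniq s -> exists rho, resampled s rho.
Proof.
elim: s => [_|i s IH /= /andP[iNs /IH[rho]]]; first exact: resampled_nil.
exact: resampled_cons.
Qed.
End resample.

(** * Redrawing all coordinates but one gives the product measure *)

Section redraw_all.
Local Open Scope ereal_scope.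
Context (R : realType) (I : finType) (d : I -> measure_display)
  (T : forall i, measurableType (d i)).

Lemma mprod_measure_unique (m1 m2 : probability (mprod T) R) :
  (forall B : forall i, set (T i), (forall i, measurable (B i)) ->
    m1 [set x | forall i, B i (x i)] = m2 [set x | forall i, B i (x i)]) ->
  forall A, measurable A -> m1 A = m2 A.
Proof.
move=> m12.
pose G : set (set (mprod T)) := [set A | exists2 B : forall i, set (T i),
  (forall i, measurable (B i)) & A = [set x | forall i, B i (x i)]].
apply: (@measure_unique _ _ _ G (fun=> setT)).
- apply/seteqP; split.
    apply: smallest_sub; first exact: smallest_sigma_algebra.
    move=> _ [i _ [A mA <-]]; apply: sub_sigma_algebra.
    (* A cylinder over [A] is the box with [A] at index [i] and the whole space elsewhere; the
       factors have different types, so membership is transported along [j = i]. *)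
    exists (fun j => [set y | forall e : j = i, A (eq_rect j (fun k => T k) y i e)]).
      move=> j; have [ji|ji] := eqVneq j i.
        subst j; rewrite (_ : [set y | _] = A)//.
        apply/seteqP; split => [y /(_ erefl)//|y Ay e].
        by rewrite (eq_irrelevance e erefl).
      rewrite (_ : [set y | _] = setT)//; apply/seteqP; split => // y _ e.
      by rewrite e eqxx in ji.
    rewrite setTI; apply/seteqP; split => [x Ax j e|x /(_ i erefl)//] /=.
    by subst j.
  apply: smallest_sub; first exact: sigma_algebra_measurable.
  by move=> _ [B mB ->]; exact: measurable_box.
- move=> _ _ [B mB ->] [C mC ->]; exists (fun i => B i `&` C i).
    by move=> i; exact: measurableI.
  apply/seteqP; split => [x [Bx Cx] i|x BCx]; first by split.
  by split => i; case: (BCx i).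
- by move=> _; exists (fun=> setT) => //; apply/seteqP; split.
- by rewrite bigcup_const.
- by move=> _ [B mB ->]; exact: m12.
- by move=> _; exact: le_lt_trans (probability_le1 m1 measurableT) (ltry _).
Qed.

Variable mu : forall i, probability (T i) R.
Variable pi : probability (mprod T) R.

Lemma redraws_box s : uniq s -> forall B : forall i, set (T i),
  (forall i, measurable (B i)) ->
  redraws mu pi s [set x | forall i, B i (x i)] =
  \prod_(i <- s) mu i (B i) * pi [set x | forall i, i \notin s -> B i (x i)].
Proof.
elim: s => [_ B mB|i s IH /= /andP[iNs us] B mB].
  rewrite big_nil mul1e; congr (pi _).
  by apply/seteqP; split => x Bx j; [move=> _|]; exact: Bx.
(* Coordinate [i] of the inner point is overwritten, so its constraint is lifted there and put on
   the redraw instead. *)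
pose B' j : set (T j) := if j == i then setT else B j.
have mB' j : measurable (B' j) by rewrite /B'; case: ifP.
have B'E j (x : mprod T) : j != i -> B' j (x j) = B j (x j).
  by move=> ji; rewrite /B' (negbTE ji).
have -> : redraws mu pi (i :: s) [set x | forall j, B j (x j)] =
    (redraws mu pi s \x mu i) ([set x | forall j, B' j (x j)] `*` B i).
  rewrite /redraws /= /redraw /pushforward; congr ((_ \x _) _).
  apply/seteqP; split=> -[x y] /=.
    move=> h; split; last by have := h i; rewrite -[mprod_upd _]/(upd x y) updE.
    move=> j; have [->|ji] := eqVneq j i; first by rewrite /B' eqxx.
    by have := h j; rewrite -[mprod_upd _]/(upd x y) upd_neq// B'E.
  move=> [h Biy] j; rewrite -[mprod_upd _]/(upd x y).
  have [ji|ji] := eqVneq j i; first by subst j; rewrite updE.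
  by rewrite upd_neq// -B'E.
rewrite product_measure1E//; last exact: measurable_box.
transitivity (\prod_(j <- s) mu j (B' j) *
    pi [set x | forall j, j \notin s -> B' j (x j)] * mu i (B i)).
  by congr (_ * _); exact: IH.
rewrite big_cons muleC -muleA; congr (_ * (_ * _)).
  apply: eq_big_seq => j js; rewrite /B'; case: eqVneq => // ji.
  by rewrite -ji js in iNs.
congr (pi _); apply/seteqP; split => x /= Bx j.
  rewrite in_cons negb_or => /andP[ji js].
  by rewrite -B'E//; exact: Bx.
move=> js; have [->|ji] := eqVneq j i; first by rewrite /B' eqxx.
by rewrite B'E//; apply: Bx; rewrite in_cons negb_or ji.
Qed.

(** One coordinate may keep its value: it is independent of the redrawn ones and already has the
    right law. This is why only N - 1 coordinates enter the rates. *)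
Lemma redraws_prod i0 s : uniq s -> (forall i, (i \in s) = (i != i0)) ->
  (forall B, measurable B -> pi [set x | B (x i0)] = mu i0 B) ->
  forall A, measurable A -> redraws mu pi s A = mprod_measure mu A.
Proof.
move=> us sE pi0; apply: mprod_measure_unique => B mB.
rewrite redraws_box// mprod_measureE// (bigD1 i0)//= muleC; congr (_ * _).
  rewrite -pi0//; congr (pi _); apply/seteqP; split => x /= Bx.
    by apply: Bx; rewrite sE eqxx.
  by move=> i; rewrite sE negbK => /eqP ->.
rewrite -[RHS]big_filter; apply: perm_big; apply: uniq_perm => //.
  by rewrite filter_uniq// index_enum_uniq.
by move=> i; rewrite sE mem_filter mem_index_enum andbT.
Qed.
End redraw_all.

(** * Bounding the divergence by a bound on the density *)

Section domination.
Local Open Scope ereal_scope.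
Context (R : realType) d (T : measurableType d).

(** On the set where [g < f], the hypothesis and the pointwise inequality force equal integrals over
    every measurable subset. Thus [f = g] almost everywhere there, and the set is null. *)
Lemma ae_le_integral (mu : {measure set T -> \bar R}) (f g : T -> \bar R) :
  mu.-integrable setT f -> measurable_fun setT g -> (forall x, 0 <= g x) ->
  (forall E, measurable E -> \int[mu]_(x in E) f x <= \int[mu]_(x in E) g x) ->
  {ae mu, forall x, f x <= g x}.
Proof.
move=> fi mg g0 fg; have mf := measurable_int _ fi.
pose A := [set: T] `&` [set x | g x < f x].
have mA : measurable A by exact: measurable_lte.
have [||E EA mE|N [mN N0 AN]] := @integral_ae_eq _ _ _ mu A mA g f.
- exact: integrableS fi.
- exact: measurable_funTS.
- apply/eqP; rewrite eq_le fg//=.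
  apply: ge0_le_integral => //; [exact: measurable_funTS..|].
  by move=> x /EA[_ /ltW].
- exists N; split=> // x /= /negP; rewrite -ltNge => gf.
  by apply: AN => /=; move/(_ (conj I gf)) => fgx; rewrite fgx ltxx in gf.
Qed.

Variables (P nu : probability T R) (B : T -> R).
Hypothesis mB : measurable_fun setT B.
Hypothesis B1 : forall x, (1 <= B x)%R.
Hypothesis nuB : forall g, measurable_fun setT g -> (forall x, 0 <= g x) ->
  \int[nu]_x g x <= \int[P]_x ((B x)%:E * g x).

Let B0 x : 0 <= (B x)%:E. Proof. by rewrite lee_fin (le_trans ler01). Qed.

Let nu_le A : measurable A -> nu A <= \int[P]_(x in A) (B x)%:E.
Proof.
move=> mA; rewrite -integral_indicT// [leRHS]integral_mkcond epatch_indic.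
by apply: (nuB (g := EFin \o \1_A)) => [|x]; [exact/measurable_EFinP|rewrite lee_fin].
Qed.

Lemma dominated_null_dominates : nu `<< P.
Proof.
apply/null_content_dominatesP => A mA A0; apply/eqP; rewrite -measure_le0.
apply: le_trans (nu_le mA) _.
by rewrite null_set_integral//; exact/measurable_funTS/measurable_EFinP.
Qed.

Let q x := Num.max 0%R (fine (Radon_Nikodym (charge_of_finite_measure nu) P x)).

Let mq : measurable_fun setT q.
Proof.
apply: measurable_maxr => //; apply: measurableT_comp => //.
by apply: measurable_int; apply: Radon_Nikodym_integrable; exact: dominated_null_dominates.
Qed.

Let RN := Radon_Nikodym_SigmaFinite.f nu P.

Let qRN : {ae P, forall x, (q x)%:E = RN x}.
Proof.
have := ae_eq_Radon_Nikodym_SigmaFinite dominated_null_dominates measurableT.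
apply: filterS => x /(_ I) RNE; rewrite /q -RNE.
have RN0 : 0 <= RN x by apply: Radon_Nikodym_SigmaFinite.f_ge0; exact: dominated_null_dominates.
rewrite max_r ?fine_ge0// fineK//.
by apply: Radon_Nikodym_SigmaFinite.f_fin_num; exact: dominated_null_dominates.
Qed.

Let qB : {ae P, forall x, (q x <= B x)%R}.
Proof.
have RNB : {ae P, forall x, RN x <= (B x)%:E}.
  apply: ae_le_integral => //.
  - by apply: Radon_Nikodym_SigmaFinite.f_integrable; exact: dominated_null_dominates.
  - exact/measurable_EFinP.
  - move=> E mE; rewrite -Radon_Nikodym_SigmaFinite.f_integral//; first exact: nu_le.
    exact: dominated_null_dominates.
by apply: filterS2 qRN RNB => x <-; rewrite lee_fin.
Qed.

Let integral_q g : measurable_fun setT g -> (forall x, 0 <= g x) ->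
  \int[P]_x ((q x)%:E * g x) = \int[nu]_x g x.
Proof.
move=> mg g0; have numu := dominated_null_dominates.
rewrite -(Radon_Nikodym_SigmaFinite.change_of_variables numu)//.
apply: ae_eq_integral => //.
- by apply: emeasurable_funM => //; exact/measurable_EFinP.
- apply: emeasurable_funM => //.
  exact: measurable_int (Radon_Nikodym_SigmaFinite.f_integrable _).
- by apply: filterS qRN => x qx _; rewrite /= qx muleC.
Qed.

(** [phi] is monotone on the positive half-line only, while [phi \o expR] is monotone on the whole
    line; the logarithm of [h] makes up for the exponential. *)
Lemma measurable_homo_comp (phi : R -> R) (h : T -> R) :
  {in `]0%R, +oo[ &, {homo phi : x y / (x <= y)%R}} ->
  measurable_fun setT h -> (forall x, (0 < h x)%R) ->
  measurable_fun setT (phi \o h).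
Proof.
move=> phi_nd mh h0.
rewrite (_ : phi \o h = (phi \o expR) \o (@ln R \o h)); last first.
  by apply/funext => x /=; rewrite lnK// posrE.
have mlnh := measurableT_comp (@measurable_ln R) mh.
apply: (measurableT_comp (f := phi \o expR)) => //.
apply: nondecreasing_measurable => // x y xy.
by apply: phi_nd; rewrite ?in_itv/= ?andbT ?expR_gt0// ler_expR.
Qed.

(** With [q] the density, [f q = q * phi q <= q * phi B] almost everywhere, and multiplying by [q]
    turns integration against [P] into integration against [nu]. *)
Lemma divergence_dominated (f phi : R -> R) : (f 0 <= 0)%R ->
  (forall x, (0 < x)%R -> f x = (x * phi x)%R) ->
  {in `]0%R, +oo[ &, {homo phi : x y / (x <= y)%R}} -> (0 <= phi 1)%R ->
  divergence f nu P <= \int[nu]_x (phi (B x))%:E.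
Proof.
move=> f0 fphi phi_nd phi1.
rewrite /divergence; case: ifPn => [_|/asboolPn]; last first.
  by move=> /(_ dominated_null_dominates).
have mphiB : measurable_fun setT (fun x => phi (B x)).
  by apply: measurable_homo_comp => // x; rewrite (lt_le_trans ltr01).
have phiB0 x : 0 <= (phi (B x))%:E.
  rewrite lee_fin (le_trans phi1)//.
  by apply: phi_nd; rewrite ?in_itv/= ?andbT ?(lt_le_trans ltr01).
rewrite -integral_q//; last exact/measurable_EFinP.
have mfq : measurable_fun setT (fun x => f (q x)).
  (* Where the density vanishes, the value 1 keeps the argument of [phi] positive; the product is
     replaced by [f 0] there. *)
  pose q' x := if (0 < q x)%R then q x else 1%R.
  have mif : measurable_fun setT (fun x => 0 < q x)%R by exact: measurable_fun_ltr.
  have mq' : measurable_fun setT q' by exact: measurable_fun_ifT.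
  rewrite (_ : (fun x => f (q x)) =
      (fun x => if (0 < q x)%R then (q x * phi (q' x))%R else f 0%R)); last first.
    apply/funext => x; rewrite /q'; case: (ltP 0%R (q x)) => q0; first by rewrite fphi.
    by congr f; apply/eqP; rewrite eq_le q0/= /q le_max lexx.
  apply: measurable_fun_ifT => //; apply: measurable_funM => //.
  apply: measurable_homo_comp => // x.
  by rewrite /q'; case: (ltP 0%R (q x)) => // _; exact: ltr01.
(* [f (q x)] may be negative. Discarding the negative part only increases the integral, and the
   positive part still obeys the bound since [phi (B x)] is nonnegative. *)
rewrite integralE; apply: (@le_trans _ _ (\int[P]_x ((EFin \o (f \o q))^\+ x))).
  by rewrite -[leRHS]adde0 leeD// leeNl oppe0 integral_ge0.
apply: ae_ge0_le_integral => //.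
- by apply: measurable_funepos; exact/measurable_EFinP.
- by move=> x _; rewrite mule_ge0// lee_fin /q le_max lexx.
- by apply: emeasurable_funM; exact/measurable_EFinP.
apply: filterS qB => x qBx _ /=.
rewrite funeposE /= -EFin_max -EFinM lee_fin ge_max.
have q_ge0 : (0 <= q x)%R by rewrite /q le_max lexx.
have phiBx : (0 <= phi (B x))%R by rewrite -lee_fin.
rewrite mulr_ge0// andbT.
have [q0|q0] := ltP 0%R (q x); last first.
  have -> : q x = 0%R by apply/eqP; rewrite eq_le q0.
  by rewrite mul0r.
rewrite fphi// ler_wpM2l// phi_nd// in_itv/= andbT//.
exact: lt_le_trans qBx.
Qed.
End domination.

(** * Upper bounds for Wasserstein distances and moments *)

Section wasserstein_bounds.
Local Open Scope ereal_scope.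
Context (R : realType).

Lemma eq_law d1 d2 (S : measurableType d1) (T : measurableType d2)
    (rho : probability S R) (m : probability T R) (f : S -> T) (A : set T) :
  measurable_fun setT f -> measurable A ->
  \int[m]_x (\1_A x)%:E = \int[rho]_s (\1_A (f s))%:E -> m A = rho (f @^-1` A).
Proof.
move=> mf mA; rewrite integral_indicT// => ->.
rewrite -[RHS]integral_indicT//.
by rewrite -[X in measurable X]setTI; exact: mf.
Qed.

Lemma wasserstein_le d (T : measurableType d) (dist : T -> T -> R) (p M : R)
    (mu nu : probability T R) kappa : (0 < p)%R -> (0 <= M)%R ->
  plans mu nu kappa ->
  \int[kappa]_z (dist z.1 z.2 `^ p)%:E <= M%:E ->
  wasserstein dist p mu nu <= (M `^ p^-1)%:E.
Proof.
move=> p0 M0 kp kM; rewrite /wasserstein -poweR_EFin.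
apply: gt0_ler_poweR.
- by rewrite invr_ge0 ltW.
- rewrite in_itv/= leey andbT; apply: le_ereal_inf_tmp => _ [k _ <-].
  by apply: integral_ge0 => z _; rewrite lee_fin powR_ge0.
- by rewrite in_itv/= leey andbT lee_fin.
- by apply: le_trans kM; apply: ereal_inf_lbound; exists kappa.
Qed.

Lemma wassersteinxx d (T : measurableType d) (dist : T -> T -> R) (p : R)
    (mu : probability T R) : (0 < p)%R ->
  measurable_fun setT (fun z : T * T => dist z.1 z.2) ->
  (forall x, dist x x = 0%R) -> wasserstein dist p mu mu <= 0.
Proof.
move=> p0 mdist distxx.
have mdiag : measurable_fun setT (fun x : T => (x, x)) by exact: measurable_fun_pair.
have [kappa kE] := law_exists mu mdiag.
have kp : plans mu mu kappa.
  move=> A mA; split.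
    rewrite (eq_law (rho := mu) mdiag)//; last 2 first.
    - exact: measurableX.
    - by rewrite kE//; apply/measurable_EFinP; apply: measurable_indic; exact: measurableX.
    by congr (mu _); apply/seteqP; split => [x []|x].
  rewrite (eq_law (rho := mu) mdiag)//; last 2 first.
  - exact: measurableX.
  - by rewrite kE//; apply/measurable_EFinP; apply: measurable_indic; exact: measurableX.
  by congr (mu _); apply/seteqP; split => [x []|x].
have := @wasserstein_le _ _ dist p 0 mu mu kappa p0 (lexx _) kp.
rewrite powR0 ?invr_eq0 ?gt_eqF//; apply.
rewrite (kE (fun z => (dist z.1 z.2 `^ p)%:E)).
- under eq_integral do rewrite /= distxx powR0 ?gt_eqF//.
  by rewrite integral0.
- by apply/measurable_EFinP; exact: (measurableT_comp (measurable_powR _)).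
- by move=> z; rewrite lee_fin powR_ge0.
Qed.

Lemma finite_moment_atoms (Y : polishType R) (p : R) (J : finType) (m : J -> R)
    (a : J -> borel Y) (nu : probability (borel Y) R) :
  (forall j, 0 <= m j)%R ->
  (forall B, measurable B -> nu B = \sum_j (m j)%:E * \d_(a j) B) ->
  finite_moment (@bdist R Y) p nu.
Proof.
move=> m0 nuE; exists point.
(* The branches are constant maps, so the base probability, here [nu], only serves to integrate
   constants. *)
have [|rho rhoE] := @mixture_probability R _ _ _ (borel Y) nu J (fun j _ => m j)
    (fun j _ => a j) (fun=> measurable_cst _) (fun=> measurable_cst _) (fun j _ => m0 j).
  rewrite -[RHS](@probability_setT _ _ _ nu) nuE//; apply: eq_bigr => j _.
  rewrite integral_cst// diracT mule1 -[RHS]mule1; congr (_ * _).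
  exact: probability_setT.
have rhoA B : measurable B -> rho B = nu B.
  move=> mB; rewrite -integral_indicT// rhoE; last 2 first.
  - exact/measurable_EFinP.
  - by move=> x; rewrite lee_fin.
  by rewrite nuE//; apply: eq_bigr => j _; rewrite integral_probability_cst.
rewrite (eq_measure_integral rho); last by move=> B mB _; exact: esym (rhoA _ mB).
rewrite (rhoE (fun y => (bdist point y `^ p)%:E)).
- under eq_bigr do rewrite integral_probability_cst.
  by rewrite sumEFin ltry.
- apply/measurable_EFinP; exact: measurable_bdist_powR.
- by move=> y; rewrite lee_fin powR_ge0.
Qed.
End wasserstein_bounds.

(** * The quantized and the resampled coupling *)

Section shadow.
Local Open Scope ereal_scope.
Context (R : realType) (N : nat) (X : 'I_N -> polishType R).
Variables (p : R) (p0 : (0 < p)%R).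

Lemma dist_prod_powR (x y : pspace X) :
  (dist_prod p x y `^ p = \sum_(i < N) (bdist (y i) (x i)) `^ p)%R.
Proof.
rewrite /dist_prod -powRrM mulVf ?gt_eqF// powRr1; last first.
  by apply: sumr_ge0 => i _; exact: powR_ge0.
by apply: eq_bigr => i _; rewrite /bdist metric_sym.
Qed.

Lemma plans_law d (S : measurableType d) (rho : probability S R)
    (f g : S -> pspace X) (m n : probability (pspace X) R)
    (kappa : probability (pspace X * pspace X)%type R) :
  measurable_fun setT f -> measurable_fun setT g ->
  (forall h, measurable_fun setT h -> (forall x, 0 <= h x) ->
    \int[m]_x h x = \int[rho]_w h (f w)) ->
  (forall h, measurable_fun setT h -> (forall x, 0 <= h x) ->
    \int[n]_x h x = \int[rho]_w h (g w)) ->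
  (forall h, measurable_fun setT h -> (forall x, 0 <= h x) ->
    \int[kappa]_z h z = \int[rho]_w h (f w, g w)) ->
  plans m n kappa.
Proof.
move=> mf mg mE nE kE A mA.
have mfg : measurable_fun setT (fun w => (f w, g w)) by exact: measurable_fun_pair.
have ind (U : set (pspace X)) : measurable U ->
    measurable_fun setT (fun x => (\1_U x : R)%:E).
  by move=> mU; apply/measurable_EFinP; exact: measurable_indic.
have ind2 (U : set (pspace X * pspace X)) : measurable U ->
    measurable_fun setT (fun x => (\1_U x : R)%:E).
  by move=> mU; apply/measurable_EFinP; exact: measurable_indic.
have kU U : measurable U -> kappa U = rho ((fun w => (f w, g w)) @^-1` U).
  move=> mU; apply: eq_law => //; apply: kE; first exact: ind2.
  by move=> x; rewrite lee_fin.
split.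
- rewrite kU; last exact: measurableX.
  rewrite (eq_law (rho := rho) mf mA); last first.
    by apply: mE; [exact: ind|move=> x; rewrite lee_fin].
  by congr (rho _); apply/seteqP; split => [x []|x].
- rewrite kU; last exact: measurableX.
  rewrite (eq_law (rho := rho) mg mA); last first.
    by apply: nE; [exact: ind|move=> x; rewrite lee_fin].
  by congr (rho _); apply/seteqP; split => [x []|x].
Qed.

Let coord_meas i : measurable_fun setT (fun x : pspace X => x i : borel (X i)).
Proof. exact: (@measurable_coord _ _ (fun i => borel (X i)) i). Qed.

Lemma coupling_integral (mu : marginals X) pi i (g : borel (X i) -> \bar R) :
  couplings mu pi -> measurable_fun setT g -> (forall x, 0 <= g x) ->
  \int[pi]_x g (x i) = \int[mu i]_z g z.
Proof.
move=> pi_mu mg g0; have [m mE] := law_exists pi (@coord_meas i).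
rewrite -mE//; apply: eq_measure_integral => A mA _.
transitivity (pi [set x | A (x i)]); last exact: pi_mu.
apply: (eq_law (rho := pi) (@coord_meas i) mA).
apply: (mE (EFin \o \1_A)); first exact/measurable_EFinP.
by move=> x; rewrite lee_fin.
Qed.

Lemma integral_coupling (mu : marginals X) (pi : probability (pspace X) R) :
  (forall i (A : set (borel (X i))), measurable A ->
    \int[pi]_x (\1_A (x i : borel (X i)))%:E = \int[mu i]_z (\1_A z)%:E) ->
  couplings mu pi.
Proof.
move=> piE i A mA; rewrite -[RHS]integral_indicT// -piE//.
apply/esym; rewrite -[RHS]integral_indicT//.
exact: (@measurable_proj _ _ (fun i => borel (X i))).
Qed.

Variables (mu nu : marginals X) (q : forall i, soft_partition (mu i)).
Variables (s : seq 'I_N) (cost : 'I_N -> R).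
Hypothesis us : uniq s.
Hypothesis nu_s : forall i, i \in s -> forall B, measurable B ->
  nu i B = \sum_(j : cell (q i)) (mass j)%:E * \d_(atom j) B.
Hypothesis nuNs : forall i, i \notin s -> nu i = mu i.
Hypothesis cost0 : forall i, (0 <= cost i)%R.
Hypothesis costE : forall i, i \in s -> \sum_(j : cell (q i)) \int[mu i]_y
  ((weight j y)%:E * (bdist (atom j) y `^ p)%:E) <= (cost i)%:E.

(** [pin] is the law of the quantized point and [pihat] that of the resampled one. The p-th power of
    [dist_prod] is a sum over coordinates, so the coordinate costs add up, and coordinates outside
    [s] contribute 0. *)
Lemma shadow (pi : probability (pspace X) R) : couplings mu pi ->
  exists pihat pin : probability (pspace X) R,
  [/\ couplings mu pihat, couplings nu pin,
    wasserstein (@dist_prod R N X p) p pi pin <= ((\sum_(i <- s) cost i) `^ p^-1)%:E,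
    wasserstein (@dist_prod R N X p) p pihat pin <= ((\sum_(i <- s) cost i) `^ p^-1)%:E &
    forall g, measurable_fun setT g -> (forall x, 0 <= g x) ->
      \int[pihat]_x g x <= \int[redraws mu pi s]_x ((densities q s x)%:E * g x)].
Proof.
move=> pi_mu.
pose T i : measurableType _ := borel (X i).
pose D i (y x : T i) : \bar R := (bdist y x `^ p)%:E.
have mD i : measurable_fun setT (fun z : T i * T i => D i z.1 z.2).
  apply/measurable_EFinP; apply: (measurableT_comp (measurable_powR p)).
  exact: measurable_bdist.
have D0 i (y x : T i) : 0 <= D i y x by rewrite lee_fin powR_ge0.
have Dxx i (x : T i) : D i x x = 0.
  by rewrite /D /bdist mdistxx powR0// gt_eqF.
have pi_int i (g : T i -> \bar R) : measurable_fun setT g -> (forall x, 0 <= g x) ->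
    \int[pi]_x g (x i) = \int[mu i]_z g z by exact: coupling_integral.
have [rho [src tgt atm srcD tgtD dom]] := resampled_exists q mD D0 Dxx pi_int us.
pose state := (pspace X * (pspace X * pspace X))%type.
have m1 : measurable_fun setT (fun w : state => w.1) by exact: measurable_fst.
have m21 : measurable_fun setT (fun w : state => w.2.1).
  exact: (measurableT_comp measurable_fst measurable_snd).
have m22 : measurable_fun setT (fun w : state => w.2.2).
  exact: (measurableT_comp measurable_snd measurable_snd).
have [pihat pihatE] := law_exists rho m22.
have [pin pinE] := law_exists rho m21.
have mind i (A : set (borel (X i))) : measurable A ->
    measurable_fun setT (fun x : pspace X => (\1_A (x i : borel (X i)) : R)%:E).
  by move=> mA; apply/measurable_EFinP; exact: measurable_indic_comp.
have ind0 i (A : set (borel (X i))) x : 0 <= (\1_A x : R)%:E by rewrite lee_fin.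
have cost_sum (f : state -> pspace X) : measurable_fun setT f ->
    (forall k, \int[rho]_w D k (w.2.1 k) (f w k) =
       if k \in s then cell_cost q D k else 0) ->
    \int[rho]_w (dist_prod p (f w) w.2.1 `^ p)%:E <= (\sum_(i <- s) cost i)%:E.
  move=> mf fE; under eq_integral do rewrite dist_prod_powR -sumEFin.
  rewrite ge0_integral_sum//=; last 2 first.
  - move=> i; apply: (measurableT_comp (@mD i) (measurable_fun_pair _ _)).
      exact: (measurableT_comp (@coord_meas i) m21).
    exact: (measurableT_comp (@coord_meas i) mf).
  - by move=> i w _; exact: D0.
  rewrite (eq_bigr (fun k => if k \in s then cell_cost q D k else 0)); last first.
    by move=> k _; exact: fE.
  rewrite -big_mkcond /= -big_uniq//= -sumEFin.
  rewrite [leLHS]big_seq [leRHS]big_seq.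
  by apply: lee_sum => i si; exact: costE.
have cost_ge0 : (0 <= \sum_(i <- s) cost i)%R by exact: sumr_ge0.
have W (f : state -> pspace X) (m : probability (pspace X) R) : measurable_fun setT f ->
    (forall h, measurable_fun setT h -> (forall x, 0 <= h x) ->
      \int[m]_x h x = \int[rho]_w h (f w)) ->
    (forall k, \int[rho]_w D k (w.2.1 k) (f w k) =
       if k \in s then cell_cost q D k else 0) ->
    wasserstein (@dist_prod R N X p) p m pin <= ((\sum_(i <- s) cost i) `^ p^-1)%:E.
  move=> mf mE fE.
  have [kappa kE] := law_exists rho (measurable_fun_pair mf m21).
  apply: (@wasserstein_le _ _ _ _ _ _ _ _ kappa) => //.
    exact: (plans_law mf m21 mE pinE kE).
  rewrite (kE (fun z => (dist_prod p z.1 z.2 `^ p)%:E)); last 2 first.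
  - apply/measurable_EFinP; under eq_fun do rewrite dist_prod_powR.
    apply: measurable_sum => i; apply: (measurableT_comp (measurable_powR p)).
    apply: (measurableT_comp (@measurable_bdist R (X i)) (measurable_fun_pair _ _)).
      exact: (measurableT_comp (@coord_meas i) measurable_snd).
    exact: (measurableT_comp (@coord_meas i) measurable_fst).
  - by move=> z; rewrite lee_fin powR_ge0.
  exact: cost_sum.
exists pihat, pin; split.
- apply: integral_coupling => i A mA.
  rewrite (pihatE (fun x => (\1_A (x i : borel (X i)))%:E)); [|exact: mind|by []].
  apply: (tgt i (EFin \o \1_A)); first exact/measurable_EFinP.
  exact: ind0.
- apply: integral_coupling => i A mA.
  rewrite (pinE (fun x => (\1_A (x i : borel (X i)))%:E)); [|exact: mind|by []].
  rewrite (atm i (EFin \o \1_A)); last 2 first.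
  + exact/measurable_EFinP.
  + exact: ind0.
  case: ifPn => [si|/nuNs -> //].
  transitivity (nu i A); last exact/esym/integral_indicT.
  rewrite nu_s//.
- by apply: (W fst) => // h mh h0; rewrite (src h).
- exact: (W (fun w => w.2.2)).
- by move=> g mg g0; rewrite pihatE//; exact: dom.
Qed.
End shadow.

Section tail_coordinates.
Context (N : nat).

Definition tail : seq 'I_N := [seq i : 'I_N <- enum 'I_N | (0 < i)%N].

Lemma mem_tail (i : 'I_N) : (i \in tail) = (0 < i)%N.
Proof. by rewrite mem_filter mem_enum andbT. Qed.

Lemma uniq_tail : uniq tail.
Proof. by rewrite filter_uniq// enum_uniq. Qed.

Lemma tail_neq (N0 : (0 < N)%N) i : (i \in tail) = (i != Ordinal N0).
Proof. by rewrite mem_tail -val_eqE /= lt0n. Qed.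

Lemma size_tail : (0 < N)%N -> size tail = N.-1.
Proof.
move=> N0; rewrite -(card_uniqP uniq_tail) (eq_card (B := predC1 (Ordinal N0))).
  by rewrite cardC1 card_ord.
by move=> i; rewrite tail_neq !inE.
Qed.

Lemma big_tail (V : Type) (idx : V) (op : Monoid.com_law idx) (F : 'I_N -> V) :
  \big[op/idx]_(i <- tail) F i = \big[op/idx]_(i < N | (0 < i)%N) F i.
Proof. by rewrite big_filter big_enum_cond. Qed.
End tail_coordinates.

(** * Effect of resampling on the transport cost *)

Section quantized_bound.
Local Open Scope ereal_scope.
Context (R : realType) (N : nat) (X : 'I_N -> polishType R).
Variables (p : R) (c : pspace X -> R) (mu : marginals X) (L C : R).
Hypotheses (p1 : (1 <= p)%R) (N0 : (0 < N)%N) (L0 : (0 <= L)%R) (C0 : (0 <= C)%R).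
Hypothesis mu_moment : forall i, finite_moment (@bdist R (X i)) p (mu i).
Hypothesis c_lip : cost_lipschitz p c mu L C.

Let p0 : (0 < p)%R. Proof. exact: lt_le_trans ltr01 p1. Qed.

(** A one-cell placeholder for coordinate 0, since the family of quantizers is indexed by all
    coordinates. *)
Lemma trivial_soft_partition d (Y : measurableType d) (m : probability Y R) :
  soft_partition m.
Proof.
refine (@SoftPartition R d Y m unit (fun _ _ => 1%R) (fun _ => point)
  (fun=> measurable_cst _) (fun _ _ => ler01) _ _).
- by move=> y; rewrite (big_pred1 tt)//; case.
- by move=> _; rewrite integral_probability_cst lte_fin ltr01.
Qed.

Lemma transport_cost_le (nu : marginals X) (M : R) pi pihat pin : (0 <= M)%R ->
  (forall i, finite_moment (@bdist R (X i)) p (nu i) /\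
     wasserstein (@bdist R (X i)) p (nu i) (mu i) <= C%:E) ->
  couplings mu pi -> couplings mu pihat -> couplings nu pin ->
  wasserstein (@dist_prod R N X p) p pi pin <= M%:E ->
  wasserstein (@dist_prod R N X p) p pihat pin <= M%:E ->
  \int[pihat]_x (c x)%:E <= \int[pi]_x (c x)%:E + (2 * (L * M))%:E.
Proof.
move=> M0 nuC pi_mu pihat_mu pin_nu Wpi Wpihat.
have lip m : couplings mu m -> wasserstein (@dist_prod R N X p) p m pin <= M%:E ->
    `| \int[m]_x (c x)%:E - \int[pin]_x (c x)%:E | <= (L * M)%:E.
  move=> m_mu Wm; apply: le_trans (c_lip nuC m_mu pin_nu) _.
  by rewrite EFinM lee_wpmul2l// lee_fin.
have := lip _ pi_mu Wpi; have := lip _ pihat_mu Wpihat.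
(* A difference of infinities is [-oo] by convention, with absolute value [+oo]; the bounds
   therefore leave only the case of three real integrals. *)
case: (\int[pi]_x (c x)%:E) => [a| |]; case: (\int[pihat]_x (c x)%:E) => [b| |];
  case: (\int[pin]_x (c x)%:E) => [e| |] //=; rewrite ?leye_eq//.
rewrite !lee_fin; rewrite !ler_norml => /andP[_ b_e] /andP[a_e _].
by lra.
Qed.

Lemma quantized_coupling (n : 'I_N -> nat) (nu : marginals X) (t : R) :
  (0 < t)%R ->
  (forall i : 'I_N, (0 < i)%N -> finitely_supported (n i) (nu i)) ->
  (forall i : 'I_N, (0 < i)%N -> wasserstein (@bdist R (X i)) p (nu i) (mu i) < t%:E) ->
  (forall i : 'I_N, (0 < i)%N -> wasserstein (@bdist R (X i)) p (nu i) (mu i) <= C%:E) ->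
  forall pi, couplings mu pi ->
  exists (q : forall i, soft_partition (mu i)) (pihat : probability (pspace X) R),
  [/\ couplings mu pihat,
    \int[pihat]_x (c x)%:E <=
      \int[pi]_x (c x)%:E + (2 * (L * (N.-1%:R `^ p^-1 * t)))%:E,
    forall g, measurable_fun setT g -> (forall x, 0 <= g x) ->
      \int[pihat]_x g x <=
      \int[prod_marginals mu]_x ((densities q (tail N) x)%:E * g x),
    forall i : 'I_N, (0 < i)%N -> (#|cell (q i)| <= n i)%N &
    forall i : 'I_N, (0 < i)%N -> empirical (n i) (nu i) ->
      forall j : cell (q i), ((n i)%:R^-1 <= mass j)%R].
Proof.
move=> t0 nu_fs nu_t nu_C pi pi_mu.
have qx i : exists q : soft_partition (mu i), (0 < i)%N -> [/\ (#|cell q| <= n i)%N,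
    forall B, measurable B -> nu i B = \sum_(j : cell q) (mass j)%:E * \d_(atom j) B,
    \sum_(j : cell q) \int[mu i]_y
      ((weight j y)%:E * (bdist (atom j) y `^ p)%:E) <= (t `^ p)%:E &
    empirical (n i) (nu i) -> forall j : cell q, ((n i)%:R^-1 <= mass j)%R].
  have [i_gt0|i_le0] := ltnP 0 i; last by exists (trivial_soft_partition (mu i)).
  have [q qE] := soft_quantization p0 (nu_fs i i_gt0) (nu_t i i_gt0).
  by exists q.
pose q i := sval (cid (qx i)).
have qE (i : 'I_N) (i_gt0 : (0 < i)%N) := svalP (cid (qx i)) i_gt0.
(* Coordinate 0 keeps its marginal, which is at distance 0 from itself. *)
pose nu' : marginals X := fun i => if (0 < i)%N then nu i else mu i.
have nu'E (i : 'I_N) : (0 < i)%N -> nu' i = nu i by move=> i_gt0; rewrite /nu' i_gt0.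
have nu'_s (i : 'I_N) : i \in tail N -> forall B, measurable B ->
    nu' i B = \sum_(j : cell (q i)) (mass j)%:E * \d_(atom j) B.
  rewrite mem_tail => i_gt0 B mB; rewrite nu'E//.
  by have [_ + _ _] := qE i i_gt0; exact.
have nu'Ns (i : 'I_N) : i \notin tail N -> nu' i = mu i.
  by rewrite mem_tail /nu' => /negbTE ->.
have costE (i : 'I_N) : i \in tail N -> \sum_(j : cell (q i)) \int[mu i]_y
    ((weight j y)%:E * (bdist (atom j) y `^ p)%:E) <= (t `^ p)%:E.
  by rewrite mem_tail => i_gt0; have [] := qE i i_gt0.
have [pihat [pin [pihat_mu pin_nu Wpi Wpihat dom]]] := shadow p0 (uniq_tail N)
  nu'_s nu'Ns (fun=> powR_ge0 t p) costE pi_mu.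
have sumE : ((\sum_(i <- tail N) t `^ p) `^ p^-1 = N.-1%:R `^ p^-1 * t)%R.
  rewrite big_const_seq count_predT size_tail// iter_addr_0 -[in LHS]mulr_natl.
  rewrite powRM ?powR_ge0// -powRrM mulfV ?gt_eqF// powRr1//.
  exact: ltW.
rewrite sumE in Wpi Wpihat.
exists q, pihat; split => //.
- apply: (transport_cost_le (nu := nu') (pin := pin)) => //.
    by rewrite mulr_ge0 ?powR_ge0// ltW.
  move=> i; rewrite /nu'; case: ifPn => [i_gt0|_]; split => //.
  + have [_ nuE _ _] := qE i i_gt0.
    apply: (@finite_moment_atoms R (X i) p _ _ _ (nu i) _ nuE) => j.
    exact/ltW/mass_gt0R.
  + exact: nu_C.
  + apply: le_trans (wassersteinxx _ p0 (@measurable_bdist R (X i)) _) _.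
      by move=> x; rewrite /bdist mdistxx.
    by rewrite lee_fin.
- move=> g mg g0; apply: le_trans (dom g mg g0) _.
  rewrite le_eqVlt; apply/orP; left; apply/eqP.
  apply: eq_measure_integral => A mA _.
  apply: (redraws_prod (i0 := Ordinal N0)) => //.
  + exact: uniq_tail.
  + by move=> i; rewrite tail_neq.
  + by move=> B mB; exact: pi_mu.
- by move=> i i_gt0; have [+ _ _ _] := qE i i_gt0.
- by move=> i i_gt0; have [_ _ _ +] := qE i i_gt0.
Qed.
End quantized_bound.

(** * The gap between regularized and unregularized transport *)

Section regularized_gap.
Local Open Scope ereal_scope.
Context (R : realType) (N : nat) (X : 'I_N -> polishType R).
Variables (p : R) (c : pspace X -> R) (mu : marginals X) (L C : R).
Hypotheses (p1 : (1 <= p)%R) (N0 : (0 < N)%N) (L0 : (0 <= L)%R) (C0 : (0 <= C)%R).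
Hypothesis mu_moment : forall i, finite_moment (@bdist R (X i)) p (mu i).
Hypothesis c_lip : cost_lipschitz p c mu L C.
Variables (f phi : R -> R) (eps : R).
Hypotheses (eps0 : (0 < eps)%R) (f0 : (f 0 <= 0)%R).
Hypothesis fphi : forall x, (0 < x)%R -> f x = (x * phi x)%R.
Hypothesis phi_nd : {in `]0%R, +oo[ &, {homo phi : x y / (x <= y)%R}}.
Hypothesis phi1 : (0 <= phi 1)%R.

Lemma OTreg_sub_OT_le (B : R) :
  (forall pi, couplings mu pi -> forall e, (0 < e)%R ->
    OTreg f eps c mu <= \int[pi]_x (c x)%:E + (B + e)%:E) ->
  OTreg f eps c mu - OT c mu <= B%:E.
Proof.
move=> H; have {}H : OTreg f eps c mu - B%:E <= OT c mu.
  apply: le_ereal_inf_tmp => _ [pi pi_mu <-].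
  rewrite leeBlDr//; apply/lee_addgt0Pr => e e0.
  by rewrite -addeA -EFinD; exact: H.
(* If [OT] is [+oo], the difference is [-oo] by convention. If it is [-oo], then [OTreg] is [-oo] as
   well and the difference is again [-oo]. *)
case: (OT c mu) H => [r| |] H.
- by rewrite leeBlDr// addeC -leeBlDr.
- by rewrite addeNy leNye.
- move: H; rewrite leeNy_eq => /eqP.
  by case: (OTreg f eps c mu) => [r| |] //=; rewrite leNye.
Qed.

Lemma regularized_gap (n : 'I_N -> nat) (nu : marginals X) (tau Phi : R) :
  (0 <= tau)%R ->
  (forall i : 'I_N, (0 < i)%N -> finitely_supported (n i) (nu i)) ->
  (forall i : 'I_N, (0 < i)%N -> wasserstein (@bdist R (X i)) p (nu i) (mu i) <= tau%:E) ->
  (forall i : 'I_N, (0 < i)%N -> wasserstein (@bdist R (X i)) p (nu i) (mu i) <= C%:E) ->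
  (forall (q : forall i, soft_partition (mu i)) (pihat : probability (pspace X) R),
    couplings mu pihat ->
    (forall i : 'I_N, (0 < i)%N -> (#|cell (q i)| <= n i)%N) ->
    (forall i : 'I_N, (0 < i)%N -> empirical (n i) (nu i) ->
      forall j : cell (q i), ((n i)%:R^-1 <= mass j)%R) ->
    \int[pihat]_x (phi (densities q (tail N) x))%:E <= Phi%:E) ->
  OTreg f eps c mu - OT c mu <=
    (2 * (L * (N.-1%:R `^ p^-1 * tau)) + eps * Phi)%:E.
Proof.
move=> tau0 nu_fs nu_tau nu_C phi_le; apply: OTreg_sub_OT_le => pi pi_mu e e0.
pose K := (2 * (L * N.-1%:R `^ p^-1))%R.
have K0 : (0 <= K)%R by rewrite !mulr_ge0// powR_ge0.
(* Extracting a plan takes a strict bound, whence [tau + eta]. The extra cost [K * eta] stays below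
   [e], and the summand 1 covers [K = 0]. *)
pose eta := (e / (K + 1))%R.
have eta0 : (0 < eta)%R by rewrite divr_gt0// ltr_wpDl.
have t0 : (0 < tau + eta)%R by rewrite ltr_wpDl.
have nu_t (i : 'I_N) : (0 < i)%N ->
    wasserstein (@bdist R (X i)) p (nu i) (mu i) < (tau + eta)%:E.
  by move=> i_gt0; apply: le_lt_trans (nu_tau i i_gt0) _; rewrite lte_fin ltrDl.
have [q [pihat [pihat_mu c_le dom q_card q_em]]] :=
  quantized_coupling p1 N0 L0 C0 mu_moment c_lip t0 nu_fs nu_t nu_C pi_mu.
have div_le : divergence f pihat (prod_marginals mu) <= Phi%:E.
  apply: le_trans (phi_le q pihat pihat_mu q_card q_em).
  apply: divergence_dominated => //; last by move=> x; exact: densities_ge1.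
  exact: measurable_densities.
apply: (@le_trans _ _ (\int[pihat]_x (c x)%:E +
    eps%:E * divergence f pihat (prod_marginals mu))).
  by apply: ereal_inf_lbound; exists pihat.
apply: (@le_trans _ _ (\int[pi]_x (c x)%:E +
    (2 * (L * (N.-1%:R `^ p^-1 * (tau + eta))))%:E + (eps * Phi)%:E)).
  by apply: leeD => //; rewrite EFinM lee_wpmul2l// lee_fin ltW.
rewrite -addeA -EFinD leeD2l// lee_fin.
have : (K * eta <= e)%R.
  rewrite /eta mulrCA ler_piMr ?(ltW e0)//.
  by rewrite ler_pdivrMr ?mul1r ?lerDl ?ltr_wpDl.
rewrite /K; move: (N.-1%:R `^ p^-1)%R (eps * Phi)%R => k m.
rewrite mulrDr mulrDr mulrDr [(L * (k * eta))%R]mulrA [(2 * (L * k * eta))%R]mulrA => h.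
by rewrite addrAC lerD2l.
Qed.
End regularized_gap.

(** * Integrating [phi] of the density bound *)

Section density_integrals.
Local Open Scope ereal_scope.
Context (R : realType).

(** Jensen's inequality from the single tangent line at [n]; its slope is nonnegative, so an upper
    bound on the mean of [h] is enough. *)
Lemma integral_supergradient d (T : measurableType d) (m : probability T R)
    (h : T -> R) (phi : R -> R) (n s : R) : measurable_fun setT h ->
  (forall x, (1 <= h x)%R) -> \int[m]_x (h x)%:E <= n%:E -> (1 <= n)%R ->
  {in `]0%R, +oo[ &, {homo phi : x y / (x <= y)%R}} -> (0 <= phi 1)%R ->
  (0 <= s)%R -> (forall x, (1 <= x)%R -> phi x <= phi n + s * (x - n))%R ->
  \int[m]_x (phi (h x))%:E <= (phi n)%:E.
Proof.
move=> mh h1 hn n1 phi_nd phi1 s0 sE.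
have phi0 x : (1 <= x -> 0 <= phi x)%R.
  move=> x1; apply: le_trans phi1 _.
  by apply: phi_nd; rewrite ?in_itv/= ?andbT ?(lt_le_trans ltr01).
have mphi : measurable_fun setT (phi \o h).
  by apply: measurable_homo_comp => // x; exact: lt_le_trans ltr01 (h1 x).
have sn0 : (0 <= s * n)%R by rewrite mulr_ge0// (le_trans ler01).
have h0 x : 0 <= (h x)%:E by rewrite lee_fin (le_trans ler01).
(* Adding [s * n] to both sides makes all integrands nonnegative, so integrals can be split
   freely. *)
rewrite -(@leeD2rE _ (s * n)%:E)//.
rewrite -[X in _ + X <= _](integral_probability_cst m) -ge0_integralD//; last 2 first.
- by move=> x _; rewrite lee_fin phi0.
- exact/measurable_EFinP.
apply: (@le_trans _ _ (\int[m]_x ((phi n)%:E + s%:E * (h x)%:E))).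
  apply: ge0_le_integral => //.
  - by move=> x _; rewrite -EFinD lee_fin addr_ge0// phi0.
  - by apply: emeasurable_funD => //; exact/measurable_EFinP.
  - apply: emeasurable_funD => //; apply: emeasurable_funM => //.
    exact/measurable_EFinP.
  - move=> x _; rewrite -EFinM -!EFinD lee_fin.
    by have := sE _ (h1 x); lra.
rewrite ge0_integralD//; last 3 first.
- by move=> x _; rewrite lee_fin phi0.
- by move=> x _; rewrite mule_ge0.
- by apply: emeasurable_funM => //; exact/measurable_EFinP.
rewrite integral_probability_cst ge0_integralZl//; last exact/measurable_EFinP.
by rewrite leeD2l// EFinM lee_wpmul2l.
Qed.

Lemma ln_supergradient (n x : R) : (1 <= n -> 1 <= x ->
  ln x <= ln n + n^-1 * (x - n))%R.
Proof.
move=> n1 x1; have n0 : (0 < n)%R := lt_le_trans ltr01 n1.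
have x0 : (0 < x)%R := lt_le_trans ltr01 x1.
have xn : (-1 < n^-1 * (x - n))%R.
  by rewrite mulrBr mulVf ?gt_eqF// ltrBrDr addNr mulr_gt0// invr_gt0.
rewrite -lerBlDl -ln_div ?posrE//.
apply: le_trans (le_ln1Dx xn); rewrite ler_ln ?posrE ?divr_gt0//; last by lra.
by rewrite mulrBr mulVf ?gt_eqF// addrC subrK mulrC.
Qed.

(* The slope is the supremum of the slopes of the chords to the right of [n]. *)
Lemma concave_supergradient (phi : R -> R) (n : R) : (0 < n)%R ->
  concave_on_pos phi -> {in `]0%R, +oo[ &, {homo phi : x y / (x <= y)%R}} ->
  exists2 s : R, (0 <= s)%R & forall x, (0 < x)%R ->
    (phi x <= phi n + s * (x - n))%R.
Proof.
move=> n0 phi_cc phi_nd.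
pose S := [set (phi y - phi n) / (y - n) | y in `]n, +oo[%classic]%R.
have slope x y : (0 < x -> x < n -> n < y ->
    (phi y - phi n) / (y - n) <= (phi n - phi x) / (n - x))%R.
  move=> x0 xn ny.
  have yx0 : (0 < y - x)%R by lra.
  have t01 : (0 <= (n - x) / (y - x) <= 1)%R.
    by rewrite divr_ge0 ?ler_pdivrMr//=; lra.
  have := phi_cc y x _ (lt_trans n0 ny) x0 t01.
  have -> : ((n - x) / (y - x) * y + (1 - (n - x) / (y - x)) * x = n)%R.
    by field; rewrite gt_eqF.
  have -> : ((n - x) / (y - x) * phi y + (1 - (n - x) / (y - x)) * phi x =
     ((n - x) * phi y + (y - n) * phi x) / (y - x))%R.
    by field; rewrite gt_eqF.
  rewrite ler_pdivrMr// => H.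
  by rewrite ler_pdivrMr ?subr_gt0// mulrAC ler_pdivlMr ?subr_gt0//; lra.
have n2 : (0 < n / 2)%R by rewrite divr_gt0.
have n2n : (n / 2 < n)%R by lra.
have S0 : S !=set0.
  by exists ((phi (n + 1) - phi n) / (n + 1 - n))%R; exists (n + 1)%R => //=; rewrite in_itv/=; lra.
have Sub x : (0 < x)%R -> (x < n)%R -> ubound S ((phi n - phi x) / (n - x))%R.
  move=> x0 xn _ [y /= + <-]; rewrite in_itv/= andbT => ny; exact: slope.
have hasS : has_sup S by split => //; eexists; exact: (Sub (n / 2)%R).
have leS y : (n < y)%R -> ((phi y - phi n) / (y - n) <= sup S)%R.
  move=> ny; apply: ub_le_sup; first by case: hasS.
  by exists y => //=; rewrite in_itv/= ny.
exists (sup S).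
  apply: le_trans (leS (n + 1)%R _); last by lra.
  rewrite divr_ge0 ?subr_ge0//; last by lra.
  by apply: phi_nd; rewrite ?in_itv/= ?andbT//; lra.
move=> x x0; have [xn|nx|->] := ltgtP x n.
- have : (sup S <= (phi n - phi x) / (n - x))%R by apply: ge_sup => //; exact: Sub.
  by rewrite ler_pdivlMr ?subr_gt0//; lra.
- by have := leS _ nx; rewrite ler_pdivrMr ?subr_gt0//; lra.
- by rewrite subrr mulr0 addr0.
Qed.
End density_integrals.

Section density_bounds.
Local Open Scope ereal_scope.
Context (R : realType) (N : nat) (X : 'I_N -> polishType R).
Variables (mu : marginals X) (q : forall i, soft_partition (mu i)).
Variable (m : probability (pspace X) R).
Hypothesis m_mu : couplings mu m.
Variable n : 'I_N -> nat.

Let coord_meas (i : 'I_N) (g : borel (X i) -> R) : measurable_fun setT g ->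
  measurable_fun setT (fun x : pspace X => g (x i : borel (X i))).
Proof.
move=> mg; apply: (measurableT_comp (f := g) mg).
exact: (@measurable_coord _ _ (fun i => borel (X i)) i).
Qed.

Lemma integral_cell_density_phi (i : 'I_N) (phi : R -> R) (s : R) :
  (0 < n i)%N -> (#|cell (q i)| <= n i)%N ->
  {in `]0%R, +oo[ &, {homo phi : x y / (x <= y)%R}} -> (0 <= phi 1)%R ->
  (0 <= s)%R ->
  (forall x, (1 <= x)%R -> phi x <= phi (n i)%:R + s * (x - (n i)%:R))%R ->
  \int[m]_x (phi (cell_density (q i) (x i)))%:E <= (phi (n i)%:R)%:E.
Proof.
move=> n0 qn phi_nd phi1 s0 sE.
have mb := measurable_cell_density (q i).
have b1 := cell_density_ge1 (q i).
rewrite (@coupling_integral R N X mu m i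
    (fun y => (phi (cell_density (q i) y))%:E))//.
- apply: (integral_supergradient (s := s)) => //.
  + by rewrite integral_cell_density lee_fin ler_nat.
  + by rewrite ler1n.
- apply/measurable_EFinP; apply: measurable_homo_comp => // y.
  exact: lt_le_trans ltr01 (b1 y).
- move=> y; rewrite lee_fin (le_trans phi1)//.
  by apply: phi_nd; rewrite ?in_itv/= ?andbT ?(lt_le_trans ltr01).
Qed.

(** The logarithm of the product is a sum of functions of one coordinate each. Their integrals
    depend on the marginals of [m] only, whatever the dependence between the coordinates. *)
Lemma integral_ln_densities :
  (forall i : 'I_N, (0 < i)%N -> (0 < n i)%N) ->
  (forall i : 'I_N, (0 < i)%N -> (#|cell (q i)| <= n i)%N) ->
  \int[m]_x (ln (densities q (tail N) x))%:E
    <= (\sum_(i <- tail N) ln (n i)%:R)%:E.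
Proof.
move=> n0 qn; have b1 i := cell_density_ge1 (q i).
have lnE x : ln (densities q (tail N) x) =
    (\sum_(i <- tail N) ln (cell_density (q i) (x i)))%R.
  rewrite /densities; elim: (tail N) => [|i s IH]; first by rewrite !big_nil ln1.
  rewrite !big_cons lnM ?IH// posrE ?(lt_le_trans ltr01)//.
  exact: (@densities_ge1 _ _ _ _ _ q s x).
under eq_integral do rewrite lnE -sumEFin.
rewrite ge0_integral_sum//; last 2 first.
- move=> i; apply/measurable_EFinP; apply: (coord_meas (g := @ln R \o cell_density (q i))).
  exact: measurableT_comp (@measurable_ln R) (measurable_cell_density (q i)).
- by move=> i x _; rewrite lee_fin ln_ge0.
rewrite -sumEFin [leLHS]big_seq [leRHS]big_seq; apply: lee_sum => i.
rewrite mem_tail => i0; have ni1 : (1 <= (n i)%:R :> R)%R by rewrite ler1n n0.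
apply: (@integral_cell_density_phi i (@ln R) ((n i)%:R^-1)%R) => //.
- exact: n0.
- exact: qn.
- by move=> x y; rewrite !in_itv/= !andbT => x0 y0 xy; rewrite ler_ln.
- by rewrite ln1.
- by move=> x x1; exact: ln_supergradient.
Qed.

(** Masses bounded below bound every factor of the density at each point, so monotonicity of [phi]
    suffices for any number of coordinates. *)
Lemma integral_densities_le (phi : R -> R) :
  {in `]0%R, +oo[ &, {homo phi : x y / (x <= y)%R}} -> (0 <= phi 1)%R ->
  (forall i : 'I_N, (0 < i)%N -> (0 < n i)%N) ->
  (forall i : 'I_N, (0 < i)%N -> forall j : cell (q i), ((n i)%:R^-1 <= mass j)%R) ->
  \int[m]_x (phi (densities q (tail N) x))%:E
    <= (phi (\prod_(i <- tail N) (n i)%:R))%:E.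
Proof.
move=> phi_nd phi1 n0 qm.
rewrite -[leRHS](integral_probability_cst m).
have d1 x := @densities_ge1 _ _ _ _ _ q (tail N) x.
have d0 x : (0 < densities q (tail N) x)%R by rewrite (lt_le_trans ltr01).
apply: ge0_le_integral => //.
- move=> x _; rewrite lee_fin (le_trans phi1)//.
  by apply: phi_nd; rewrite ?in_itv/= ?andbT.
- apply/measurable_EFinP; apply: measurable_homo_comp => //.
  exact: measurable_densities.
- move=> x _; rewrite lee_fin; apply: phi_nd; rewrite ?in_itv/= ?andbT//.
    rewrite big_seq prodr_gt0// => i; rewrite mem_tail => i0.
    by rewrite ltr0n n0.
  rewrite /densities [leLHS]big_seq [leRHS]big_seq; apply: ler_prod => i.
  rewrite mem_tail => i0; rewrite (le_trans ler01) ?cell_density_ge1//=.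
  by apply: cell_density_le; [exact: qm|rewrite ltr0n n0].
Qed.
End density_bounds.

(** * Choosing the number of atoms *)

Section grid.
Context (R : realType).

Lemma quantization_size (alpha S : R) : 0 < alpha <= 1 -> 1 <= S ->
  {n : nat | [/\ (0 < n)%N, n%:R <= S `^ alpha^-1 & n%:R `^ (- alpha) <= 2 / S]}.
Proof.
move=> /andP[a0 a1] S1; have S0 : 0 < S := lt_le_trans ltr01 S1.
pose x := S `^ alpha^-1.
have x1 : 1 <= x by rewrite -[leLHS](powRr0 S) ler_powR// invr_ge0 ltW.
have [xn nx] := andP (truncn_itv (le_trans ler01 x1)).
have n0 : (0 < Num.truncn x)%N by rewrite truncn_gt0.
exists (Num.truncn x); split => //.
have x0 : 0 < x := lt_le_trans ltr01 x1.
have xS : x `^ alpha = S by rewrite /x -powRrM mulVf ?gt_eqF// powRr1// ltW.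
have x2n : x / 2 <= (Num.truncn x)%:R.
  rewrite ler_pdivrMr// mulr_natr mulr2n; apply: le_trans (ltW nx) _.
  by rewrite -natr1 lerD2l ler1n.
rewrite powRN -[2 / S]invf_div lef_pV2 ?posrE ?divr_gt0 ?powR_gt0 ?ltr0n//.
apply: (@le_trans _ _ ((x / 2) `^ alpha)); last first.
  by rewrite ge0_ler_powR ?nnegrE// ltW// divr_gt0.
rewrite powRM ?invr_ge0 ?(ltW x0)// xS ler_pM2l//.
by rewrite ger1_powR// invr_gt0 ltr0n invf_le1 ?ler1n.
Qed.

Lemma empirical_finitely_supported (Y : polishType R) n
    (nu : probability (borel Y) R) : (0 < n)%N ->
  empirical n nu -> finitely_supported n nu.
Proof.
move=> n0 [y yE].
pose y' k := if insub k is Some i then y i else point.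
exists (y' @` `I_n); first exact: card_image_le.
rewrite yE; last first.
  apply: borel_measurable_finite; apply: finite_image; exact: finite_II.
rewrite (eq_bigr (fun=> 1%E)); last first.
  move=> i _; rewrite diracE mem_set//; exists i => //=.
  by rewrite /y' valK.
rewrite sumEFin sumr_const card_ord -EFinM mulVf// pnatr_eq0.
by rewrite -lt0n.
Qed.
End grid.

(** * Continuity of [phi] and the asymptotics of S *)

Section xmul_function.
Context (R : realType) (phi : R -> R).
Hypothesis phi_nd : {in `]0, +oo[ &, {homo phi : x y / x <= y}}.

Lemma xmulE x : x != 0 -> xmul phi x = x * phi x.
Proof. by rewrite /xmul => /negbTE ->. Qed.

(* If the limit defining [xmul phi 0] fails to exist, its junk value is 0. *)
Lemma xmul0_le0 : phi 1 = 0 -> xmul phi 0 <= 0.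
Proof.
move=> phi1; rewrite /xmul eqxx.
have [cv|ncv] := pselect (cvg (y * phi y @[y --> 0^'+])).
  apply: limr_le => //; near=> y.
  have y0 : 0 < y by near: y; exact: nbhs_right_gt.
  rewrite pmulr_rle0// -phi1; apply: phi_nd; rewrite ?in_itv/= ?andbT//.
  by near: y; apply: nbhs_right_le.
by rewrite (dvgP ncv).
Unshelve. all: by end_near. Qed.

Hypothesis convex : forall x y t, 0 <= x -> 0 <= y -> x != y -> 0 < t < 1 ->
  xmul phi (t * x + (1 - t) * y) < t * xmul phi x + (1 - t) * xmul phi y.

(* Near x, the values of phi lie between phi x and the chord of y * phi y over
   [x, 2x]. *)
Lemma xmul_convex_continuous x : 0 < x -> {for x, continuous phi}.
Proof.
move=> x0.
have chord a b c : 0 < a -> a < b -> b < c ->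
    b * phi b <= (c - b) / (c - a) * (a * phi a) + (b - a) / (c - a) * (c * phi c).
  move=> a0 ab bc; have ca : 0 < c - a by lra.
  have t01 : 0 < (c - b) / (c - a) < 1.
    by rewrite divr_gt0 ?ltr_pdivrMr//=; lra.
  have := convex (ltW a0) (ltW (lt_trans a0 (lt_trans ab bc))) _ t01.
  have -> : (c - b) / (c - a) * a + (1 - (c - b) / (c - a)) * c = b.
    by field; rewrite gt_eqF.
  have -> : 1 - (c - b) / (c - a) = (b - a) / (c - a) by field; rewrite gt_eqF.
  have xmulE' u : 0 < u -> xmul phi u = u * phi u by move=> u0; rewrite xmulE// gt_eqF.
  rewrite !xmulE'; [|lra..] => h; apply/ltW/h.
  by apply/eqP => ac; lra.
pose D := phi (2 * x) - phi x.
have D0 : 0 <= D.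
  by rewrite subr_ge0; apply: phi_nd; rewrite ?in_itv/= ?andbT; lra.
(* The chords give [t * u <= 2 * D * |x - t|] for the difference [u], and [t > x / 2] replaces the
   factor [t] by [x / 2]. *)
pose K := 4 * D / x.
have K0 : 0 <= K by rewrite !mulr_ge0// invr_ge0 ltW.
have lip t : x / 2 < t -> t < 2 * x -> `|phi x - phi t| <= K * `|x - t|.
  move=> xt tx; have t0 : 0 < t by lra.
  have tK u : 0 <= u -> t * u <= 2 * D * `|x - t| -> u <= K * `|x - t|.
    move=> u0 tu; rewrite /K mulrAC ler_pdivlMr//.
    have : u * x <= 2 * (t * u) by rewrite mulrA [u * x]mulrC ler_wpM2r//; lra.
    by move: tu; move: (`|x - t|) => r tu ux; apply: le_trans ux _; lra.
  have [xt'|tx'|->] := ltgtP x t; last by rewrite !subrr normr0 mulr0.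
  - have phi_le : phi x <= phi t.
      by apply: phi_nd; rewrite ?in_itv/= ?andbT// ltW.
    rewrite distrC ger0_norm ?subr_ge0//; apply: tK; first by rewrite subr_ge0.
    rewrite distrC gtr0_norm ?subr_gt0//.
    have := chord x t (2 * x) x0 xt' tx.
    have -> : (2 * x - t) / (2 * x - x) * (x * phi x) +
        (t - x) / (2 * x - x) * (2 * x * phi (2 * x)) =
        (2 * x - t) * phi x + (t - x) * (2 * phi (2 * x)).
      by field; apply/eqP; lra.
    by rewrite /D; lra.
  - have phi_le : phi t <= phi x.
      by apply: phi_nd; rewrite ?in_itv/= ?andbT// ltW.
    rewrite ger0_norm ?subr_ge0//; apply: tK; first by rewrite subr_ge0.
    rewrite gtr0_norm ?subr_gt0//.
    have x2x : x < 2 * x by lra.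
    have := chord t x (2 * x) t0 tx' x2x.
    have -> : (2 * x - x) / (2 * x - t) * (t * phi t) +
        (x - t) / (2 * x - t) * (2 * x * phi (2 * x)) =
        x * ((t * phi t + (x - t) * (2 * phi (2 * x))) / (2 * x - t)).
      by field; apply/eqP; lra.
    rewrite ler_pM2l// ler_pdivlMr; last by lra.
    by rewrite /D; lra.
apply/cvgrPdist_lt => e e0.
have K1 : 0 < K + 1 by rewrite ltr_wpDl.
near=> t.
apply: le_lt_trans (lip t _ _) _.
- by near: t; apply: lt_nbhsr; lra.
- by near: t; apply: lt_nbhsl; lra.
apply: (@le_lt_trans _ _ ((K + 1) * `|x - t|)).
  by rewrite ler_wpM2r// lerDl.
rewrite mulrC -ltr_pdivlMr//; near: t.
apply: (@cvgr_dist_lt _ _ _ _ _ (fun t => t)); first exact: cvg_id.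
by rewrite divr_gt0.
Unshelve. all: by end_near. Qed.

Variables (beta : R).
Hypothesis beta_gt0 : 0 < beta.
Hypothesis phi_oo : phi x @[x --> +oo] --> +oo.
Let G := xmul (fun x => phi (x `^ beta)).

Let GE x : 0 < x -> G x = x * phi (x `^ beta).
Proof. by move=> x0; rewrite /G /xmul gt_eqF. Qed.

Let G_continuous x : 0 < x -> {for x, continuous G}.
Proof.
move=> x0.
have xb0 : 0 < x `^ beta by rewrite powR_gt0.
have cH : {for x, continuous (fun y : R => y * phi (y `^ beta) : R)}.
  apply: continuousM => //.
  apply: (@continuous_comp _ _ _ (fun y : R => y `^ beta) phi); last exact: xmul_convex_continuous.
  apply: differentiable_continuous; apply/derivable1_diffP.
  by apply: derivable_powR; rewrite in_itv/= andbT.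
rewrite /prop_for/continuous_at GE//; apply: (cvg_trans _ cH).
apply: near_eq_cvg; near=> y.
by rewrite GE//; near: y; exact: lt_nbhsr.
Unshelve. all: by end_near. Qed.

Lemma phi_powR_large (A : R) : exists M, forall x, M <= x -> A <= phi (x `^ beta).
Proof.
have /cvgryPge/(_ A) [B [_ BA]] := phi_oo.
exists ((`|B| + 1) `^ beta^-1) => x Bx; apply: BA.
apply: lt_le_trans (_ : `|B| + 1 <= _).
  by rewrite (le_lt_trans (ler_norm B))// ltrDl.
have -> : `|B| + 1 = ((`|B| + 1) `^ beta^-1) `^ beta.
  by rewrite -powRrM mulVf ?gt_eqF// powRr1.
by rewrite ge0_ler_powR ?nnegrE ?powR_ge0 ?(ltW beta_gt0)// (le_trans _ Bx)// powR_ge0.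
Qed.

(** Intermediate value theorem on [M, b], where [b >= 1] and [phi (b]^
    beta)[exceeds both]v[and 0; the sign is what makes]G b >= phi (b [^ beta)]. *)
Lemma xmul_powR_surjective (M v : R) : 0 < M -> G M <= v ->
  exists2 x, M <= x & G x = v.
Proof.
move=> M0 Mv; have [B BE] := phi_powR_large (Num.max v 0).
pose b := Num.max (Num.max M B) 1.
have Mb : M <= b by rewrite !le_max lexx.
have b1 : 1 <= b by rewrite !le_max lexx !orbT.
have vGb : v <= G b.
  rewrite GE ?(lt_le_trans ltr01)//.
  have : Num.max v 0 <= phi (b `^ beta) by apply: BE; rewrite !le_max lexx orbT.
  rewrite ge_max => /andP[vphi phi0]; apply: le_trans vphi _.
  by rewrite ler_peMl.
have [||x] := @IVT _ G M b v Mb.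
- apply: continuous_in_subspaceT => x; rewrite inE/= in_itv/= => /andP[Mx _].
  by apply: G_continuous; exact: lt_le_trans Mx.
- by rewrite ge_min Mv/= le_max vGb orbT.
- by rewrite in_itv/= => /andP[Mx _] Gx; exists x.
Qed.

Variables (x0 : R) (Ginv : R -> R).
Hypothesis x0_ge0 : 0 <= x0.
Hypothesis GK : {in `[x0, +oo[, cancel G Ginv}.

(** [Ginv] is constrained only on the image of [x0, +oo), so 1 / eps must first be seen to lie in
    that image. It does as soon as 1 / eps is at least [G M]. *)
Let Ginv_large M : 0 < M -> x0 <= M ->
  \forall eps \near 0^'+, exists2 x, M <= x & G x = 1 / eps /\ Ginv (1 / eps) = x.
Proof.
move=> M0 xM; pose g := Num.max (G M) 1.
have g0 : 0 < g by rewrite lt_max ltr01 orbT.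
near=> e.
have e0 : 0 < e by near: e; exact: nbhs_right_gt.
have eg : e <= g^-1 by near: e; apply: nbhs_right_le; rewrite invr_gt0.
have GMe : G M <= 1 / e.
  rewrite div1r; apply: (@le_trans _ _ g); first by rewrite le_max lexx.
  by rewrite -[leLHS]invrK lef_pV2// posrE invr_gt0.
have [x Mx Gx] := xmul_powR_surjective M0 GMe.
exists x => //; split => //; rewrite -Gx GK// in_itv/= andbT.
exact: le_trans xM Mx.
Unshelve. all: by end_near. Qed.

Lemma xmul_powR_inv_cvgy : Ginv (1 / eps) @[eps --> 0^'+] --> +oo.
Proof.
apply/cvgryPge => A; pose M := Num.max (Num.max A x0) 1.
have := @Ginv_large M; rewrite lt_max ltr01 orbT => /(_ isT).
rewrite {1}/M !le_max lexx orbT => /(_ isT); apply: filterS => e [x Mx [_ ->]].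
by apply: le_trans Mx; rewrite !le_max lexx.
Qed.

(** For [x = Ginv (1 / eps)], the equation [x * phi (x]^ beta) = 1 / eps[turns]eps *
    x[into the inverse of]phi (x [^ beta)], which tends to 0. *)
Lemma xmul_powR_inv_cvg0 : eps * Ginv (1 / eps) @[eps --> 0^'+] --> 0.
Proof.
apply/cvgrPdist_le => e e0.
have [B BE] := phi_powR_large e^-1; pose M := Num.max (Num.max B x0) 1.
have M0 : 0 < M by rewrite lt_max ltr01 orbT.
have xM : x0 <= M by rewrite !le_max lexx orbT.
have BM : B <= M by rewrite !le_max lexx.
near=> eps.
have eps0 : 0 < eps by near: eps; exact: nbhs_right_gt.
have : exists2 x, M <= x & G x = 1 / eps /\ Ginv (1 / eps) = x.
  by near: eps; exact: Ginv_large.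
move=> [x Mx [Gx ->]]; have x_gt0 : 0 < x := lt_le_trans M0 Mx.
have phix : e^-1 <= phi (x `^ beta) by apply: BE; exact: le_trans Mx.
have epsE : eps * x = (phi (x `^ beta))^-1.
  have phi0 : phi (x `^ beta) != 0 by rewrite gt_eqF// (lt_le_trans _ phix)// invr_gt0.
  move: Gx; rewrite GE// => Gx; apply: (mulIf phi0).
  by rewrite mulVf// -mulrA Gx div1r divff// gt_eqF.
rewrite sub0r normrN epsE ger0_norm; last first.
  by rewrite invr_ge0 (le_trans _ phix)// invr_ge0 ltW.
by rewrite -[leRHS]invrK lef_pV2// posrE ?invr_gt0// (lt_le_trans _ phix)// invr_gt0.
Unshelve. all: by end_near. Qed.
End xmul_function.

(** * Balancing the two errors *)

Section rates.
Context (R : realType) (p : R) (N : nat) (X : 'I_N -> polishType R).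
Variables (mu : marginals X) (c : pspace X -> R) (alpha : 'I_N -> R) (L C : R).
Hypotheses (p1 : 1 <= p) (N0 : (0 < N)%N).
Hypothesis mu_moment : forall i, finite_moment (@bdist R (X i)) p (mu i).
Hypothesis alpha01 : forall i : 'I_N, (0 < i)%N -> 0 < alpha i <= 1.
Hypotheses (L0 : 0 <= L) (C0 : 0 <= C).
Hypothesis c_lip : cost_lipschitz p c mu L C.

Let beta := \sum_(i < N | (0 < i)%N) (alpha i)^-1.
Let K := 4 * N.-1%:R `^ p^-1 * L * C.

Lemma choose_tail (P : forall i, probability (borel (X i)) R -> Prop) :
  (forall i : 'I_N, (0 < i)%N -> exists nu, P i nu) ->
  exists nu : marginals X, forall i : 'I_N, (0 < i)%N -> P i (nu i).
Proof.
move=> ex_nu; have nu_ex (i : 'I_N) : exists nu, (0 < i)%N -> P i nu.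
  have [i0|i0] := ltnP 0 i; last by exists (mu i).
  by have [nu Pnu] := ex_nu i i0; exists nu.
by exists (fun i => sval (cid (nu_ex i))) => i; exact: (svalP (cid (nu_ex i))).
Qed.

Lemma quantized_gap (f phi : R -> R) (eps S : R) (n : 'I_N -> nat)
    (nu : marginals X) (Phi : R) :
  0 < eps -> f 0 <= 0 -> (forall x, 0 < x -> f x = x * phi x) ->
  {in `]0, +oo[ &, {homo phi : x y / x <= y}} -> 0 <= phi 1 -> 1 <= S ->
  (forall i : 'I_N, (0 < i)%N -> (0 < n i)%N) ->
  (forall i : 'I_N, (0 < i)%N -> (n i)%:R `^ (- alpha i) <= 2 / S) ->
  (forall i : 'I_N, (0 < i)%N -> finitely_supported (n i) (nu i)) ->
  (forall i : 'I_N, (0 < i)%N -> (wasserstein (@bdist R (X i)) p (nu i) (mu i) <=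
     (C * (n i)%:R `^ (- alpha i))%:E)%E) ->
  (forall (q : forall i, soft_partition (mu i)) (pihat : probability (pspace X) R),
    couplings mu pihat ->
    (forall i : 'I_N, (0 < i)%N -> (#|cell (q i)| <= n i)%N) ->
    (forall i : 'I_N, (0 < i)%N -> empirical (n i) (nu i) ->
      forall j : cell (q i), (n i)%:R^-1 <= mass j) ->
    (\int[pihat]_x (phi (densities q (tail N) x))%:E <= Phi%:E)%E) ->
  (OTreg f eps c mu - OT c mu <= (K / S + eps * Phi)%:E)%E.
Proof.
move=> eps0 f0 fphi phi_nd phi1 S1 n0 nS nu_fs nu_W Phi_le.
have S0 : 0 < S := lt_le_trans ltr01 S1.
have -> : K / S + eps * Phi =
    2 * (L * (N.-1%:R `^ p^-1 * (C * (2 / S)))) + eps * Phi.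
  by rewrite /K; field; rewrite gt_eqF.
apply: (regularized_gap p1 N0 L0 C0 mu_moment c_lip eps0 f0 fphi phi_nd phi1
  (n := n) (nu := nu)) => //.
- by rewrite mulr_ge0// divr_ge0// ltW.
- move=> i i0; apply: le_trans (nu_W i i0) _.
  by rewrite lee_fin ler_wpM2l// nS.
(* A power of [n i >= 1] with negative exponent is at most 1, so the quantized marginals stay in the
   ball of radius [C] where the cost estimate applies. *)
- move=> i i0; apply: le_trans (nu_W i i0) _.
  rewrite lee_fin ler_piMr// powRN invf_le1 ?powR_gt0 ?ltr0n ?n0//.
  rewrite -[leLHS](powRr0 (n i)%:R) ler_powR ?ler1n ?n0//.
  by case/andP: (alpha01 i0) => /ltW.
Qed.

Let betaE : beta = \sum_(i <- tail N) (alpha i)^-1.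
Proof. by rewrite big_tail. Qed.

Lemma quantization_sizes (S : R) : 1 <= S -> exists n : 'I_N -> nat,
  [/\ forall i : 'I_N, (0 < i)%N -> (0 < n i)%N,
    forall i : 'I_N, (0 < i)%N -> (n i)%:R <= S `^ (alpha i)^-1 &
    forall i : 'I_N, (0 < i)%N -> (n i)%:R `^ (- alpha i) <= 2 / S].
Proof.
move=> S1; have n_ex (i : 'I_N) : exists n : nat, (0 < i)%N -> [/\ (0 < n)%N,
    n%:R <= S `^ (alpha i)^-1 & n%:R `^ (- alpha i) <= 2 / S].
  have [i0|i0] := ltnP 0 i; last by exists 0%N.
  by have [n nE] := quantization_size (alpha01 i0) S1; exists n.
exists (fun i => sval (cid (n_ex i))).
by split=> i i0; have [] := svalP (cid (n_ex i)) i0.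
Qed.

Lemma prod_quantization_sizes (S : R) (n : 'I_N -> nat) : 0 < S ->
  (forall i : 'I_N, (0 < i)%N -> (n i)%:R <= S `^ (alpha i)^-1) ->
  \prod_(i <- tail N) (n i)%:R <= S `^ beta.
Proof.
move=> S0 nS; apply: (@le_trans _ _ (\prod_(i <- tail N) S `^ (alpha i)^-1)).
  rewrite [leLHS]big_seq [leRHS]big_seq; apply: ler_prod => i.
  by rewrite mem_tail => i0; rewrite ler0n nS.
rewrite betaE; elim: (tail N) => [|i s IH]; first by rewrite !big_nil powRr0.
rewrite !big_cons powRD; last by apply/implyP => _; rewrite gt_eqF.
by rewrite ler_wpM2l// powR_ge0.
Qed.

Lemma entropic_rate (eps : R) : 0 < eps <= 1 ->
  (forall i : 'I_N, (0 < i)%N -> quant p C (alpha i) (mu i)) ->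
  (OTreg (fun x => x * ln x)%R eps c mu - OT c mu
    <= (beta * (eps * ln (1 / eps)) + K * eps)%:E)%E.
Proof.
move=> /andP[eps0 eps1] mu_quant.
have S1 : 1 <= 1 / eps by rewrite div1r invf_ge1.
have S0 : 0 < 1 / eps := lt_le_trans ltr01 S1.
have [n [n0 nS nC]] := quantization_sizes S1.
have [nu nuE] := choose_tail (P := fun i nu => finitely_supported (n i) nu /\
  (wasserstein (@bdist R (X i)) p nu (mu i) <=
     (C * (n i)%:R `^ (- alpha i))%:E)%E)
  (fun i i0 => let: ex_intro2 nu h1 h2 := mu_quant i i0 (n i) (n0 i i0) in
     ex_intro _ nu (conj h1 h2)).
apply: le_trans (quantized_gap (phi := @ln R) (S := 1 / eps) (n := n) (nu := nu)
  (Phi := \sum_(i <- tail N) ln (n i)%:R) eps0 _ _ _ _ S1 n0 nC _ _ _) _ => //.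
- by rewrite mul0r.
- by move=> x y; rewrite !in_itv/= !andbT => x0 y0 xy; rewrite ler_ln.
- by rewrite ln1.
- by move=> i i0; have [] := nuE i i0.
- by move=> i i0; have [] := nuE i i0.
- by move=> q pihat pihat_mu qn _; exact: integral_ln_densities.
rewrite lee_fin invf_div divr1 addrC lerD2r mulrCA ler_pM2l//.
rewrite betaE mulr_suml [leLHS]big_seq [leRHS]big_seq; apply: ler_sum => i.
rewrite mem_tail => i0; rewrite -ln_powR ler_ln ?posrE ?powR_gt0 ?ltr0n ?n0//.
exact: nS.
Qed.

Lemma superlinear_rate (phi : R -> R) (eps S : R) :
  0 < eps -> xmul phi 1 = 0 -> {in `]0, +oo[ &, {homo phi : x y / x <= y}} ->
  (N = 2%N /\ concave_on_pos phi /\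
     (forall i : 'I_N, (0 < i)%N -> quant p C (alpha i) (mu i))
   \/ (forall i : 'I_N, (0 < i)%N -> quant_em p C (alpha i) (mu i))) ->
  1 <= S -> xmul (fun x => phi (x `^ beta)) S = 1 / eps ->
  (OTreg (xmul phi) eps c mu - OT c mu <= ((K + 1) / S)%:E)%E.
Proof.
move=> eps0 f1 phi_nd quant_or S1 fS.
have S0 : 0 < S := lt_le_trans ltr01 S1.
have phi1 : phi 1 = 0 by move: f1; rewrite xmulE ?oner_eq0// mul1r.
(* The equation defining [S] says that the divergence error is exactly 1 / S: the summand 1 in
   [K + 1]. *)
have phiS : eps * phi (S `^ beta) = S^-1.
  move: fS; rewrite xmulE ?gt_eqF// => fS; apply: (mulfI (lt0r_neq0 S0)).
  by rewrite mulrCA fS div1r !divff// gt_eqF.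
have [n [n0 nS nC]] := quantization_sizes S1.
have -> : (K + 1) / S = K / S + eps * phi (S `^ beta) by rewrite phiS mulrDl mul1r.
have prod_gt0 : 0 < \prod_(i <- tail N) (n i)%:R :> R.
  by rewrite big_seq prodr_gt0// => i; rewrite mem_tail => i0; rewrite ltr0n n0.
have phi_prod : phi (\prod_(i <- tail N) (n i)%:R) <= phi (S `^ beta).
  apply: phi_nd; rewrite ?in_itv/= ?andbT ?powR_gt0//.
  exact: prod_quantization_sizes.
have [nu [nu_fs nu_W Phi_le]] : exists nu : marginals X,
  [/\ forall i : 'I_N, (0 < i)%N -> finitely_supported (n i) (nu i),
    forall i : 'I_N, (0 < i)%N -> (wasserstein (@bdist R (X i)) p (nu i) (mu i) <=
     (C * (n i)%:R `^ (- alpha i))%:E)%E &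
    forall (q : forall i, soft_partition (mu i)) (pihat : probability (pspace X) R),
    couplings mu pihat ->
    (forall i : 'I_N, (0 < i)%N -> (#|cell (q i)| <= n i)%N) ->
    (forall i : 'I_N, (0 < i)%N -> empirical (n i) (nu i) ->
      forall j : cell (q i), (n i)%:R^-1 <= mass j) ->
    (\int[pihat]_x (phi (densities q (tail N) x))%:E
       <= (phi (\prod_(i <- tail N) (n i)%:R))%:E)%E].
  case: quant_or => [[N2 [phi_cc mu_quant]]|mu_quant].
  - have [nu nuE] := choose_tail (P := fun i nu => finitely_supported (n i) nu /\
      (wasserstein (@bdist R (X i)) p nu (mu i) <=
         (C * (n i)%:R `^ (- alpha i))%:E)%E)
      (fun i i0 => let: ex_intro2 nu h1 h2 := mu_quant i i0 (n i) (n0 i i0) in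
         ex_intro _ nu (conj h1 h2)).
    exists nu; split=> [i i0|i i0|q pihat pihat_mu qn _].
    + by have [] := nuE i i0.
    + by have [] := nuE i i0.
    (* For N = 2 a single coordinate is quantized, so the density bound depends on that coordinate
       alone and one tangent line of [phi] suffices. *)
    + have [i tailE] : exists i, tail N = [:: i].
        have : size (tail N) = 1%N by rewrite size_tail// N2.
        by case: (tail N) => [|i [|]]// _; exists i.
      have i0 : (0 < i)%N by rewrite -mem_tail tailE mem_head.
      rewrite tailE big_seq1.
      under eq_integral do rewrite /densities big_seq1.
      have [|s s0 sE] := concave_supergradient (n := (n i)%:R) _ phi_cc phi_nd.
        by rewrite ltr0n n0.
      apply: (@integral_cell_density_phi R N X mu q pihat pihat_mu n i phi s) => //.
      * exact: n0.
      * exact: qn.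
      * by rewrite phi1.
      * by move=> x x1; apply: sE; exact: lt_le_trans x1.
  - have [nu nuE] := choose_tail (P := fun i nu => empirical (n i) nu /\
      (wasserstein (@bdist R (X i)) p nu (mu i) <=
         (C * (n i)%:R `^ (- alpha i))%:E)%E)
      (fun i i0 => let: ex_intro2 nu h1 h2 := mu_quant i i0 (n i) (n0 i i0) in
         ex_intro _ nu (conj h1 h2)).
    exists nu; split=> [i i0|i i0|q pihat pihat_mu _ qm].
    + by have [/(empirical_finitely_supported (n0 i i0))] := nuE i i0.
    + by have [] := nuE i i0.
    + apply: integral_densities_le => //; first by rewrite phi1.
      by move=> i i0; apply: qm => //; have [] := nuE i i0.
apply: (quantized_gap (phi := phi) (n := n) (nu := nu)) => //.
- exact: xmul0_le0.
- by move=> x x_gt0; rewrite xmulE// gt_eqF.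
- by rewrite phi1.
- move=> q pihat pihat_mu qn qm; apply: le_trans (Phi_le q pihat pihat_mu qn qm) _.
  by rewrite lee_fin.
Qed.
End rates.

Theorem theorem3p3 (R : realType) (p : R) (N : nat) (X : 'I_N -> polishType R)
    (mu : marginals X) (c : pspace X -> R) (alpha : 'I_N -> R) (L C : R) :
  1 <= p -> (0 < N)%N ->
  (forall i, finite_moment (@bdist R (X i)) p (mu i)) ->
  continuous (c : prod_topology X -> R) ->
  growth p c ->
  (forall i : 'I_N, (0 < i)%N -> 0 < alpha i <= 1) ->
  0 <= L -> 0 <= C ->
  cost_lipschitz p c mu L C ->
  let beta := \sum_(i < N | (0 < i)%N) (alpha i)^-1 in
  let K := 4 * N.-1%:R `^ p^-1 * L * C in
  ((forall i : 'I_N, (0 < i)%N -> quant p C (alpha i) (mu i)) ->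
    forall eps : R, 0 < eps <= 1 ->
      (OTreg (fun x => x * ln x)%R eps c mu - OT c mu
        <= (beta * (eps * ln (1 / eps)) + K * eps)%:E)%E)
  /\
  (forall (phi : R -> R) (x0 y0 : R) (ftilde_inv : R -> R),
    let f := xmul phi in
    let ftilde := xmul (fun x => phi (x `^ beta)) in
    divergence_function f ->
    0 <= x0 -> 0 <= y0 ->
    {in `[x0, +oo[ &, {homo ftilde : x y / x < y}} ->
    {in `[x0, +oo[, cancel ftilde ftilde_inv} ->
    {in `]0, +oo[ &, {homo phi : x y / x <= y}} ->
    (N = 2%N /\ concave_on_pos phi /\
      (forall i : 'I_N, (0 < i)%N -> quant p C (alpha i) (mu i))
     \/
     (forall i : 'I_N, (0 < i)%N -> quant_em p C (alpha i) (mu i))) ->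
    let S eps := ftilde_inv (1 / eps) in
    [/\ S eps @[eps --> 0^'+] --> +oo,
        eps * S eps @[eps --> 0^'+] --> 0 &
        forall eps : R, 0 < eps -> (eps%:E <= x0%:E^-1)%E ->
          (ftilde @` `[x0, +oo[) (1 / eps) ->
          y0 `^ (1 / beta) + 1 <= S eps ->
          (OTreg f eps c mu - OT c mu <= ((K + 1) / S eps)%:E)%E]).
Proof.
move=> p1 N0 mu_moment _ _ alpha01 L0 C0 c_lip beta K; split.
  by move=> mu_quant eps eps01; exact: entropic_rate.
move=> phi x0 y0 ftilde_inv f ftilde [convex _ f1 f_oo] x0_ge0 y0_ge0.
move=> ftilde_lt ftildeK phi_nd quant_or S.
have phi1 : phi 1 = 0 by move: f1; rewrite /f xmulE ?oner_eq0// mul1r.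
(* For [beta = 0], as when N = 1, [ftilde] would vanish on the positive half-line because
   [phi 1 = 0], against its strict monotonicity. *)
have beta_gt0 : 0 < beta.
  have : 0 <= beta.
    by apply: sumr_ge0 => i /alpha01/andP[/ltW ai _]; rewrite invr_ge0.
  rewrite le_eqVlt => /predU1P[beta0|//].
  have ftilde0 x : 0 < x -> ftilde x = 0.
    by move=> x_gt0; rewrite /ftilde xmulE ?gt_eqF// -beta0 powRr0 phi1 mulr0.
  have : ftilde (x0 + 1) < ftilde (x0 + 2).
    by apply: ftilde_lt; rewrite ?in_itv/= ?andbT; lra.
  by rewrite !ftilde0 ?ltxx//; lra.
have phi_oo : phi x @[x --> +oo] --> +oo.
  apply: cvg_trans f_oo; apply: near_eq_cvg; near=> x.
  have x_gt0 : 0 < x by near: x; exact: nbhs_pinfty_gt.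
  by rewrite /f xmulE ?gt_eqF// mulrAC divff ?gt_eqF// mul1r.
split.
- exact: xmul_powR_inv_cvgy ftildeK.
- exact: xmul_powR_inv_cvg0 ftildeK.
- move=> eps eps0 _ [z zx0 zE] S1.
  apply: (superlinear_rate (alpha := alpha)) => //.
    (* The summand 1 in the threshold ensures [1 <= S], so that at least one atom is available in
       each coordinate. *)
    by apply: le_trans S1; rewrite lerDr powR_ge0.
  by rewrite /S -zE ftildeK.
Unshelve. all: by end_near. Qed.
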